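(* For every graph $G$ of order $n\le 11$, $\gamma(G)=\gamma^\infty(G)$ if and only if $\gamma(G)=\theta(G)$.
   Context: All graphs are finite and simple. A dominating set of $G$ is a set $D\subseteq V(G)$ such that every vertex of $V(G)\setminus D$ has a neighbour in $D$; the domination number $\gamma(G)$ is the minimum cardinality of a dominating set. Eternal domination game on $G$: a defender chooses a dominating set $D_0\subseteq V(G)$ with $|D_0|=k$ and places one guard on each vertex of $D_0$. At each time $t=1,2,3,\dots$ an attacker selects (attacks) a vertex $v$ carrying no guard, and the defender must respond by moving one guard located on a neighbour of $v$ to $v$ (all other guards stay; at most one guard per vertex). The defender wins if they can respond to every attack forever (equivalently, the guards always occupy a dominating set); otherwise the attacker wins. The eternal domination number $\gamma^\infty(G)$ is the minimum $k$ for which $k$ guards suffice to respond to any sequence of attacks on $G$. The clique covering number $\theta(G)$ is the minimum number of parts in a partition of $V(G)$ into sets each inducing a clique. *)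

(* Defs.v *)
From mathcomp Require Import all_boot.
From mathcomp Require Import boolp.

Set Implicit Arguments.
Unset Strict Implicit.
Unset Printing Implicit Defensive.

(* A graph is given by its vertex type [T] and its adjacency relation [e];
   simplicity ([symmetric e], [irreflexive e]) is a hypothesis of the theorem. *)

Section Graph.

Variables (T : finType) (e : rel T).

Definition dominating (D : {set T}) : bool :=
  [forall v, (v \notin D) ==> [exists u in D, e u v]].

Lemma dominatingT : dominating [set: T].
Proof. by apply/forallP => v; rewrite in_setT. Qed.

(* The default value of each [arg min] below satisfies its condition
   ([dominatingT], [clique_partition_set1]), so these are true minima. *)
Definition domination_number : nat :=
  #|[arg min_(D < [set: T] | dominating D) #|D| ]|.

Definition clique (B : {set T}) : bool :=
  [forall x in B, forall y in B, (x != y) ==> e x y].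

Definition clique_partition (P : {set {set T}}) : bool :=
  partition P [set: T] && [forall B in P, clique B].

Lemma clique_partition_set1 : clique_partition [set [set x] | x : T].
Proof.
apply/andP; split; last first.
  apply/forall_inP => _ /imsetP[x _ ->].
  by do 2!apply/forall_inP => ? /set1P->; rewrite eqxx.
apply/and3P; split.
- rewrite eqEsubset subsetT; apply/subsetP => x _.
  by apply/bigcupP; exists [set x]; rewrite ?set11 ?imset_f.
- apply/trivIsetP => _ _ /imsetP[x _ ->] /imsetP[y _ ->] neq_xy.
  by rewrite disjoints1 in_set1; apply: contra_neq neq_xy => ->.
- by apply/imsetP => -[x _ /setP/(_ x)]; rewrite in_set0 set11.
Qed.

Definition clique_covering_number : nat :=
  #|[arg min_(P < [set [set x] | x : T] | clique_partition P) #|P| ]|.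

(* A strategy may depend on all the previous attacks, listed with the most
   recent one first: when [v] is attacked after the attacks [h], the guard on
   the vertex [s h v] is moved to [v]. *)
Definition strategy := seq T -> T -> T.

(* The set of guarded vertices after the attacks [h]. *)
Fixpoint guards (D0 : {set T}) (s : strategy) (h : seq T) : {set T} :=
  if h is v :: h' then v |: (guards D0 s h' :\ s h' v) else D0.

Fixpoint legal_attacks (D0 : {set T}) (s : strategy) (h : seq T) : bool :=
  if h is v :: h' then legal_attacks D0 s h' && (v \notin guards D0 s h')
  else true.

(* The defender survives forever iff every attack occurring at some finite
   time is answered by moving a guard from a neighbour of the attacked vertex. *)
Definition winning (D0 : {set T}) (s : strategy) : Prop :=
  forall (h : seq T) (v : T),
    legal_attacks D0 s h -> v \notin guards D0 s h ->
    s h v \in guards D0 s h /\ e (s h v) v.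

Definition guards_suffice (k : nat) : Prop :=
  exists D0 : {set T},
    [/\ dominating D0, #|D0| = k & exists s : strategy, winning D0 s].

Lemma guards_suffice_card : guards_suffice #|T|.
Proof.
exists [set: T]; split; [exact: dominatingT | exact: cardsT |].
pose s : strategy := fun _ v => v; exists s => h v.
suff guardsT : legal_attacks [set: T] s h -> guards [set: T] s h = [set: T].
  by move=> /guardsT ->; rewrite in_setT.
by elim: h => //= w h IHh /andP[/IHh ->]; rewrite in_setT.
Qed.

Lemma guards_suffice_ex : exists k, `[< guards_suffice k >].
Proof. by exists #|T|; apply/asboolP; exact: guards_suffice_card. Qed.

Definition eternal_domination_number : nat := ex_minn guards_suffice_ex.

End Graph.

(* Main.v *)
Require Import Defs.
From mathcomp Require Import all_boot zify.
From mathcomp Require Import boolp.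
From Stdlib Require Import BinNat.

Set Implicit Arguments.
Unset Strict Implicit.
Unset Printing Implicit Defensive.

(** A guard on each clique of a minimum clique partition answers every attack,
    so gamma <= gamma^oo <= theta always, and one has to show that
    gamma = gamma^oo = k forces theta <= k, that is, that the complement H of G
    has a proper k-colouring. Two facts are used: any fewer than k vertices have
    a common H-neighbour (since gamma = k), and the reachable guard positions F
    are closed under attacks. Vertices that no position of F guards
    simultaneously are interchangeable as guards and form an equivalence
    relation. If some position of F is such that every vertex is H-adjacent to
    all its classes but one, colouring each vertex by the missing class is
    proper. Otherwise H contains an explicit configuration with 7 vertices if
    k = 3, and with k + 2 vertices if k >= 4. A vertex whose H-neighbourhood is
    contained in that of another one can be removed, by induction; a case
    analysis on the adjacencies of the remaining vertices, at most 11 in all,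
    then always ends in a contradiction or in a k-colouring. The case trees are
    found by an unverified search and checked by a verified checker. *)

(** * Guard configurations *)

(** The configurations come from two [k]-cliques of H sharing [k-2] vertices, J+pq and J+xy.
    Vertices joined to a same [(k-1)]-clique are interchangeable; so if one of x, y is a twin of
    neither p nor q, no edge of H joins xy to pq. Attacks on p, q, x, y then force, up to naming,
    the positions J+px and J+qy, which are not cliques of H: these are what the case analysis
    exploits. For k = 3 this prescribes only 5 vertices. The colouring criterion is therefore
    refined: it suffices that the vertices lying in several triangles, up to twins, be pairwise
    non-adjacent in H. Otherwise two of them are adjacent; with a triangle on them and the above
    construction at each of the two, this makes 3 + 2 + 2 = 7 vertices. *)

Section SubstNth.
Variable T : Type.
Fixpoint subst_nth (t : seq T) (i : nat) (w : T) : seq T :=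
  match t, i with
  | [::], _ => [::]
  | x :: t', O => w :: t'
  | x :: t', S i' => x :: subst_nth t' i' w
  end.
End SubstNth.

Section SubstNthTheory.
Variable T : Type.
Implicit Types (t s : seq T) (w : T).

Lemma size_subst_nth t i w : size (subst_nth t i w) = size t.
Proof. by elim: t i => [|x t IH] [|i] //=; rewrite IH. Qed.

Lemma nth_subst_nth x0 t i w j :
  i < size t -> nth x0 (subst_nth t i w) j = if j == i then w else nth x0 t j.
Proof.
elim: t i j => [|x t IH] [|i] [|j] //= lt_i.
by rewrite IH // eqSS.
Qed.

Lemma subst_nth_take x0 t s i : size t = size s -> i < size t ->
  subst_nth (take i t ++ drop i s) i (nth x0 t i) = take i.+1 t ++ drop i.+1 s.
Proof.
elim: t s i => [|x t IH] [|y s] [|i] //= [eq_sz] lt_i; first by rewrite take0 !drop0.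
by rewrite IH.
Qed.

Lemma map_subst_nth (U : Type) (f : T -> U) t i w :
  map f (subst_nth t i w) = subst_nth (map f t) i (f w).
Proof. by elim: t i => [|x t IH] [|i] //=; rewrite IH. Qed.

Lemma subst_nth_nth x0 t i : subst_nth t i (nth x0 t i) = t.
Proof. by elim: t i => [|x t IH] [|i] //=; rewrite IH. Qed.
End SubstNthTheory.

Lemma perm_subst_nth (T : eqType) (x0 : T) t i w : i < size t ->
  perm_eq (nth x0 t i :: subst_nth t i w) (w :: t).
Proof.
move=> lt_i; apply/permP => P; elim: t i lt_i => [|x t IH] [|i] //= lt_i.
  by rewrite addnCA.
by have /= e := IH i lt_i; rewrite addnCA e addnCA.
Qed.

Lemma mem_subst_nth (T : finType) (x0 : T) (t : seq T) i w : uniq t -> w \notin t -> i < size t ->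
  uniq (subst_nth t i w) /\
  [set x in subst_nth t i w] = w |: ([set x in t] :\ nth x0 t i).
Proof.
move=> Ut wt lt_i; have Hp := perm_subst_nth x0 w lt_i.
have : uniq (w :: t) by rewrite /= wt.
rewrite -(perm_uniq Hp) /= => /andP[n_notin U']; split=> //.
apply/setP => x; rewrite !inE; have := perm_mem Hp x; rewrite !inE.
case: (eqVneq x (nth x0 t i)) => [->|neq] /=; last by move=> ->.
by rewrite (negbTE n_notin) orbF; case: eqVneq => // eqw; rewrite -eqw mem_nth in wt.
Qed.

Section Guards.
Variables (T : finType) (h : rel T).
Hypotheses (h_sym : symmetric h) (h_irr : irreflexive h).

(* [h] is the complement of the graph: a guard on [u] can answer an attack on [v]
   iff [~~ h u v]. [eternal_far] says that the domination number on [V] is not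
   less than [k]. *)
Record eternal (k : nat) (V : {set T}) (F : {set {set T}}) : Prop := Eternal {
  eternal_ex : exists S, S \in F;
  eternal_sub : forall S, S \in F -> S \subset V;
  eternal_card : forall S, S \in F -> #|S| = k;
  eternal_att : forall S v, S \in F -> v \in V -> v \notin S ->
    exists2 u, u \in S & ~~ h u v && (v |: (S :\ u) \in F);
  eternal_far : forall W : {set T}, W \subset V -> #|W| < k ->
    exists2 v, v \in V & {in W, forall w, h w v} }.

Definition colorable (k : nat) (V : {set T}) :=
  exists2 f : T -> nat, {in V, forall x, f x < k} &
    {in V &, forall x y, h x y -> f x != f y}.

Definition is_clique (K : {set T}) := {in K &, forall x y, x != y -> h x y}.

Lemma clique_extend k (V K : {set T}) :
  (forall W : {set T}, W \subset V -> #|W| < k -> exists2 v, v \in V & {in W, forall w, h w v}) ->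
  K \subset V -> is_clique K -> #|K| <= k ->
  exists K' : {set T}, [/\ K \subset K', K' \subset V, is_clique K' & #|K'| = k].
Proof.
move=> far; have [m] := ubnP (k - #|K|).
elim: m K => // m IH K lt_m KV Kc; rewrite leq_eqVlt => /predU1P[eq_k|lt_k].
  by exists K.
have [v vV vK] := far K KV lt_k.
have vnK : v \notin K by apply/negP => /vK; rewrite h_irr.
have [|||| K' [sK K'V K'c K'k]] := IH (v |: K).
- by rewrite cardsU1 vnK /= -ltnS (leq_trans _ lt_m) // ltnS subnS prednK // subn_gt0.
- by rewrite subUset sub1set vV.
- move=> x y /setU1P[->|xK] /setU1P[->|yK] neq; rewrite ?eqxx // in neq *.
  + by rewrite h_sym vK.
  + by rewrite vK.
  + exact: Kc.
- by rewrite cardsU1 vnK.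
by exists K'; split=> //; apply: subset_trans sK; apply: subsetUr.
Qed.

(** * Interchangeable vertices *)

Section Classes.
Variables (k : nat) (V : {set T}) (F : {set {set T}}).
Hypothesis etF : eternal k V F.

(* Attacking the vertices of a [k]-clique of [h] one by one brings all the guards there. *)
Lemma clique_guarded (K : {set T}) : K \subset V -> is_clique K -> #|K| = k -> K \in F.
Proof.
move=> KV Kc Kk; have [S0 S0F] := eternal_ex etF.
have [m] := ubnP (k - #|S0 :&: K|); elim: m S0 S0F => // m IH S SF lt_m.
have [sKS|/subsetPn[v vK vS]] := boolP (K \subset S).
  suff -> : K = S by [].
  by apply/eqP; rewrite eqEcard sKS Kk (eternal_card etF SF) leqnn.
have [u uS /andP[nh S'F]] := eternal_att etF SF (subsetP KV v vK) vS.
(* A guard on [K] is [h]-adjacent to [v] and cannot answer, so each answer brings one more guard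
   into [K]. *)
have uK : u \notin K.
  apply: contra nh => uK; apply: Kc => //.
  by apply: contraTneq uS => ->.
apply: (IH _ S'F); rewrite -ltnS (leq_trans _ lt_m) // ltnS.
have sub : v |: (S :&: K) \subset (v |: S :\ u) :&: K.
  apply/subsetP => x /setU1P[->|/setIP[xS xK]]; first by rewrite !inE eqxx.
  by rewrite !inE xS xK andbT orbC; case: eqVneq xK uK => // -> ->.
have := subset_leq_card sub; rewrite cardsU1 inE (negbTE vS) /= add1n => le_c.
have le_k : #|(v |: S :\ u) :&: K| <= k by rewrite -Kk subset_leq_card // subsetIr.
by rewrite ltn_sub2l // (leq_trans le_c).
Qed.

(* Distinct vertices never guarded simultaneously; they can replace each other in
   any position ([inc_swap]). *)
Definition inc x y := (x == y) || [forall S in F, ~~ ((x \in S) && (y \in S))].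

Lemma inc_refl x : inc x x. Proof. by rewrite /inc eqxx. Qed.

Lemma inc_sym x y : inc x y = inc y x.
Proof. by rewrite /inc eq_sym; congr (_ || _); apply: eq_forallb => S; rewrite andbC. Qed.

Lemma incP x y (S : {set T}) : inc x y -> S \in F -> x \in S -> y \in S -> x = y.
Proof. by case/predU1P => // /forall_inP incxy /incxy + xS yS; rewrite xS yS. Qed.

Lemma guard_at x : x \in V -> exists2 S, S \in F & x \in S.
Proof.
move=> xV; have [S SF] := eternal_ex etF; have [xS|xS] := boolP (x \in S); first by exists S.
by have [u _ /andP[_ S'F]] := eternal_att etF SF xV xS; exists (x |: S :\ u); rewrite ?setU11.
Qed.

(** Only the guard on [x] can answer an attack on [y]: after any other answer, [x] and [y] would be
    guarded together. *)
Lemma inc_swap (S : {set T}) x y : y \in V -> inc x y -> S \in F -> x \in S ->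
  (y |: (S :\ x) \in F) && ~~ h x y.
Proof.
move=> yV incxy SF xS; have [<-|neq] := eqVneq x y; first by rewrite h_irr setD1K ?SF.
have yS : y \notin S by apply: contra_neqN neq => yS; apply: incP incxy SF xS yS.
have [u uS /andP[nh S'F]] := eternal_att etF SF yV yS.
have [eq_u|neq_u] := eqVneq u x; first by rewrite -eq_u S'F.
have eqxy : x = y by apply: (incP incxy S'F); rewrite !inE ?eqxx // xS [x == u]eq_sym neq_u orbT.
by rewrite eqxy eqxx in neq.
Qed.

Lemma inc_nh x y : x \in V -> y \in V -> inc x y -> ~~ h x y.
Proof. by move=> xV yV ixy; have [S SF xS] := guard_at xV; case/andP: (inc_swap yV ixy SF xS). Qed.

(** If a position guarded both [x] and [z], swapping [x] for [y] would give one guarding [y] and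
    [z]. *)
Lemma inc_trans y x z : y \in V -> inc x y -> inc y z -> inc x z.
Proof.
move=> yV ixy iyz; rewrite /inc; case: eqVneq => //= neq.
apply/forall_inP => S SF; apply/negP => /andP[xS zS].
have /andP[S'F _] := inc_swap yV ixy SF xS.
have eqyz : y = z by apply: (incP iyz S'F); rewrite !inE ?eqxx // zS [z == x]eq_sym neq orbT.
by have := incP ixy SF xS; rewrite eqyz zS => /(_ isT) eqxz; rewrite eqxz eqxx in neq.
Qed.

(** * Positions as lists, up to twins *)

Definition guarded (t : seq T) := [&& uniq t, size t == k & [set x in t] \in F].

Lemma guarded_size t : guarded t -> size t = k. Proof. by case/and3P => _ /eqP. Qed.

Lemma guarded_V t x : guarded t -> x \in t -> x \in V.
Proof. by case/and3P => _ _ /(eternal_sub etF)/subsetP sub xt; apply: sub; rewrite inE. Qed.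

Lemma guarded_perm s t : perm_eq s t -> guarded s = guarded t.
Proof.
move=> st; rewrite /guarded (perm_uniq st) (perm_size st); congr [&& _, _ & _ \in F].
by apply/setP => x; rewrite !inE (perm_mem st).
Qed.

Lemma guarded_enum (S : {set T}) : S \in F -> guarded (enum S).
Proof.
move=> SF; rewrite /guarded enum_uniq -cardE (eternal_card etF SF) eqxx /=.
by rewrite (_ : [set x in enum S] = S) //; apply/setP => x; rewrite inE mem_enum.
Qed.

Lemma guarded_subst x0 t i w : guarded t -> i < k -> w \notin t ->
  w |: ([set x in t] :\ nth x0 t i) \in F -> guarded (subst_nth t i w).
Proof.
case/and3P => Ut /eqP tk _ lt_i wt S'F.
have lt_i' : i < size t by rewrite tk.
have [U' e] := mem_subst_nth x0 Ut wt lt_i'.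
by rewrite /guarded U' size_subst_nth tk eqxx e.
Qed.

Lemma guarded_swap x0 t i y : guarded t -> i < k -> y \in V -> inc (nth x0 t i) y -> guarded (subst_nth t i y).
Proof.
move=> Ftt lt_i yV ity; have [Ut /eqP tk tF] := and3P Ftt.
have [eqy|neq] := eqVneq (nth x0 t i) y; first by rewrite -eqy subst_nth_nth.
have nt : nth x0 t i \in [set x in t] by rewrite inE mem_nth ?tk.
apply: (guarded_subst (x0 := x0)) => //; last by case/andP: (inc_swap yV ity tF nt).
by apply: contra neq => yt; apply/eqP/(incP ity tF nt); rewrite inE.
Qed.

Lemma guarded_inc x0 s t : guarded s -> size t = k ->
  (forall i, i < k -> (nth x0 t i \in V) && inc (nth x0 s i) (nth x0 t i)) -> guarded t.
Proof.
move=> Fs tk st; have sk := guarded_size Fs.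
(* The twins are substituted one index at a time, through lists mixing [t] and [s]. *)
suff mix m : m <= k -> guarded (take m t ++ drop m s).
  by have := mix k (leqnn k); rewrite -{1}tk -sk take_size drop_size cats0.
elim: m => [|m IH] lt_m; first by rewrite take0 drop0.
have /andP[tV tinc] := st _ lt_m.
rewrite -(subst_nth_take x0) ?tk ?sk //; apply: (guarded_swap (x0 := x0)) => //; first exact/IH/ltnW.
by rewrite nth_cat size_takel ?tk ?(ltnW lt_m) // ltnn subnn nth_drop addn0.
Qed.

(* If [w] is [seen] from [x] then no guard on [x] can answer an attack on [w], even
   if [h w x] fails: the guard could as well stand on a twin of [x] adjacent to [w]. *)
Definition seen w x := [exists y in V, inc x y && h w y].

Lemma seen_h w x : x \in V -> h w x -> seen w x.
Proof. by move=> xV hwx; apply/exists_inP; exists x => //; rewrite inc_refl. Qed.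

Lemma seen_self w : w \in V -> ~~ seen w w.
Proof.
move=> wV; apply/negP => /exists_inP[y yV /andP[iwy hwy]].
by have := inc_nh wV yV iwy; rewrite hwy.
Qed.

(** Every guard seen from [w] is replaced by a twin [h]-adjacent to [w], so that only an unseen
    guard can answer; after the answer, the other guards are swapped back. *)
Lemma guarded_attack x0 t w : guarded t -> w \in V ->
  exists i, [/\ i < k, ~~ seen w (nth x0 t i) & guarded (subst_nth t i w)].
Proof.
move=> Ftt wV; have tk := guarded_size Ftt.
pose g x := if [pick y | [&& y \in V, inc x y & h w y]] is Some y then y else x.
have gP x : x \in V -> [/\ g x \in V, inc x (g x) & seen w x = h w (g x)].
  move=> xV; rewrite /g; case: pickP => [y /and3P[yV ixy hwy]|no].
    by split=> //; rewrite hwy; apply/exists_inP; exists y => //; rewrite ixy.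
  split=> //; first exact: inc_refl.
  apply/idP/idP => [|/(seen_h xV)//].
  by case/exists_inP => y yV /andP[ixy hwy]; move: (no y); rewrite yV ixy hwy.
have g_id x : ~~ seen w x -> g x = x.
  rewrite /g; case: pickP => // y /and3P[yV ixy hwy] /negP[].
  by apply/exists_inP; exists y => //; rewrite ixy.
have tV i : i < k -> nth x0 t i \in V by move=> lt_i; rewrite (guarded_V Ftt) // mem_nth ?tk.
have gt_nth i : i < k -> nth x0 (map g t) i = g (nth x0 t i).
  by move=> lt_i; rewrite (nth_map x0) ?tk.
have Fg : guarded (map g t).
  apply: (guarded_inc (x0 := x0) Ftt); rewrite ?size_map // => i lt_i.
  by rewrite gt_nth //; have [-> -> _] := gP _ (tV i lt_i).
have back i : i < k -> ~~ seen w (nth x0 t i) -> guarded (subst_nth (map g t) i w) -> guarded (subst_nth t i w).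
  move=> lt_i _ F'; apply: (guarded_inc (x0 := x0) F'); rewrite ?size_subst_nth // => j lt_j.
  rewrite !nth_subst_nth ?size_map ?tk //; case: eqP => _; first by rewrite wV inc_refl.
  by rewrite gt_nth // tV // inc_sym; have [_ -> _] := gP _ (tV j lt_j).
(* If [w] is guarded here, it already was in [t], since a seen guard is replaced by a neighbour of
   [w]; the substitution then changes nothing. *)
have [wg|wg] := boolP (w \in map g t).
  have lt_i : index w (map g t) < k by rewrite -tk -(size_map g) index_mem.
  have eqw : g (nth x0 t (index w (map g t))) = w by rewrite -gt_nth // nth_index.
  have ns : ~~ seen w (nth x0 t (index w (map g t))).
    by have [_ _ ->] := gP _ (tV _ lt_i); rewrite eqw h_irr.
  exists (index w (map g t)); split=> //.
  by rewrite -[X in subst_nth _ _ X]eqw g_id // subst_nth_nth.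
have wg' : w \notin [set x in map g t] by rewrite inE.
have /and3P[_ _ FgF] := Fg.
have [u ug /andP[nh S'F]] := eternal_att etF FgF wV wg'.
rewrite inE in ug.
have lt_i : index u (map g t) < k by rewrite -tk -(size_map g) index_mem.
have equ : nth x0 (map g t) (index u (map g t)) = u by rewrite nth_index.
have ns : ~~ seen w (nth x0 t (index u (map g t))).
  by have [_ _ ->] := gP _ (tV _ lt_i); rewrite -gt_nth // equ h_sym.
exists (index u (map g t)); split=> //; apply: back => //.
by apply: (guarded_subst (x0 := x0)) => //; rewrite equ.
Qed.

Lemma guarded_dist t : guarded t -> pairwise (fun x y => ~~ inc x y) t.
Proof.
case/and3P => Ut _ tF; have sub : {subset t <= [set x in t]} by move=> x; rewrite inE.
move: [set x in t] tF sub => S SF; elim: t Ut => //= x s IH /andP[xs Us] sub.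
rewrite IH // ?andbT => [|y ys]; last by rewrite sub // inE ys orbT.
apply/allP => y ys; apply: contra xs => ixy.
by rewrite (incP ixy SF) // sub // inE ?eqxx ?ys ?orbT.
Qed.

Lemma guarded_clique t : {subset t <= V} -> size t = k -> pairwise h t -> guarded t.
Proof.
move=> tV tk ht.
have Ut : uniq t.
  elim: t ht {tV tk} => //= x s IH /andP[/allP hx /IH ->]; rewrite andbT.
  by apply/negP => /hx; rewrite h_irr.
rewrite /guarded Ut tk eqxx /=; apply: clique_guarded.
- by apply/subsetP => x; rewrite inE => /tV.
- move=> x y; rewrite !inE; elim: t ht {tV tk Ut} => //= z s IH /andP[/allP hz hs].
  rewrite !inE => /predU1P[->|xs] /predU1P[->|ys]; rewrite ?eqxx // => neq.
  + exact: hz.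
  + by rewrite h_sym hz.
  + exact: IH.
- by rewrite -tk cardsE; apply/card_uniqP.
Qed.

Lemma attack_set (S : {set T}) w : S \in F -> w \in V ->
  exists2 u, u \in S & ~~ seen w u && (w |: (S :\ u) \in F).
Proof.
move=> SF wV; have [wS|wS] := boolP (w \in S).
  by exists w => //; rewrite (seen_self wV) setD1K.
have [i [lt_i ns F']] := guarded_attack w (guarded_enum SF) wV.
have lt_i' : i < size (enum S) by rewrite -cardE (eternal_card etF).
exists (nth w (enum S) i); first by rewrite -mem_enum mem_nth.
have [|_ e] := mem_subst_nth w (enum_uniq _) (_ : w \notin enum S) lt_i'; first by rewrite mem_enum.
rewrite ns; case/and3P: F' => _ _; rewrite e; congr (_ |: (_ :\ _) \in F).
by apply/setP => x; rewrite inE mem_enum.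
Qed.

(* If [b] and [z] were guarded together, attacking the vertices of [cs] one
   after the other would keep them all guarded: [k.+1] guards. *)
Lemma inc_of_chain b z cs : b \in V -> z \in V -> {subset cs <= V} ->
  size cs = k.-1 -> 0 < k -> all (h b) cs -> all (h z) cs ->
  pairwise (fun x y => seen y x) cs -> inc b z.
Proof.
move=> bV zV csV sz k_gt0 hb hz hcs; apply/negPn/negP; rewrite negb_or => /andP[bz].
rewrite negb_forall => /existsP[S0]; rewrite negb_imply negbK => /and3P[S0F bS0 zS0].
have [S [SF bS zS csS]] : exists S : {set T},
    [/\ S \in F, b \in S, z \in S & {subset cs <= S}].
  elim/last_ind: cs csV hb hz hcs {sz} => [|cs c IH] csV; first by exists S0.
  rewrite !all_rcons pairwise_rcons => /andP[hbc hb] /andP[hzc hz] /andP[/allP sc hcs].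
  have cV : c \in V by apply: csV; rewrite mem_rcons mem_head.
  have [|S [SF bS zS csS]] := IH _ hb hz hcs.
    by move=> x xcs; apply: csV; rewrite mem_rcons inE xcs orbT.
  have [u uS /andP[ns S'F]] := attack_set SF cV.
  (* A guard seen from [c] is not the one that answers the attack on [c]. *)
  have keep x : x \in S -> seen c x -> x \in c |: S :\ u.
    by move=> xS cx; rewrite !inE xS andbT; apply/orP; right; apply: contraTneq cx => ->.
  exists (c |: S :\ u); split=> //.
  - by apply: keep => //; apply: seen_h; rewrite // h_sym.
  - by apply: keep => //; apply: seen_h; rewrite // h_sym.
  - move=> x; rewrite mem_rcons inE => /predU1P[->|xcs]; first by rewrite setU11.
    by apply: keep; [apply: csS | apply: sc].
have Ucs : uniq [:: b, z & cs].
  have nb x y : all (h x) y -> x \notin y by move=> /allP xy; apply/negP => /xy; rewrite h_irr.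
  rewrite /= inE negb_or bz nb // nb //=.
  elim: cs csV hcs {hb hz sz csS} => //= x s IH sV /andP[/allP hx hs].
  rewrite IH // => [|y ys]; last by apply: sV; rewrite inE ys orbT.
  by rewrite andbT; apply/negP => /hx; apply/negP/seen_self/sV/mem_head.
have /subset_leq_card : [set x in [:: b, z & cs]] \subset S.
  by apply/subsetP => x; rewrite !inE => /or3P[/eqP->|/eqP->|/csS].
by rewrite (eternal_card etF SF) cardsE (card_uniqP Ucs) /= sz prednK // ltnn.
Qed.

(* By [eternal_far], the hypothesis implies that every vertex sees all the classes of
   [t] but one, by which it is coloured. *)
Lemma colorable_of_far t : guarded t ->
  (forall x0 i j, i < j < k -> exists J : {set T}, [/\ J \subset V, #|J|.+1 < k &
     forall w, w \in V -> {in J, forall x, h x w} ->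
       inc (nth x0 t i) w || inc (nth x0 t j) w]) ->
  colorable k V.
Proof.
move=> Ftt far; have tk := guarded_size Ftt.
have tV x0 i : i < k -> nth x0 t i \in V by move=> lt_i; rewrite (guarded_V Ftt) // mem_nth ?tk.
(* A common neighbour [w] of [u] and [J] is a twin of one of the two guards, which is thus seen from
   [u]. *)
have two x0 u i j : u \in V -> i < j < k -> seen u (nth x0 t i) || seen u (nth x0 t j).
  move=> uV lt_ij; have [J [JV Jk PJ]] := far x0 _ _ lt_ij.
  have [||w wV wJ] := eternal_far etF (_ : u |: J \subset V).
  - by rewrite subUset sub1set uV.
  - by apply: leq_ltn_trans Jk; rewrite cardsU1; case: (_ \notin _); rewrite ?add1n // add0n.
  have hu : h u w by apply: wJ; rewrite setU11.
  have /(PJ w wV) : {in J, forall x, h x w} by move=> x xJ; apply: wJ; rewrite !inE xJ orbT.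
  by case/orP => iw; apply/orP; [left | right]; apply/exists_inP; exists w; rewrite // iw.
have others x0 u i j : u \in V -> i < k -> j < k -> j != i ->
    ~~ seen u (nth x0 t i) -> seen u (nth x0 t j).
  move=> uV lt_i lt_j neq ns; have [lt|lt|eq] := ltngtP i j; last by rewrite eq eqxx in neq.
    by have := two x0 u i j uV; rewrite lt lt_j (negbTE ns) => /(_ isT).
  by have := two x0 u j i uV; rewrite lt lt_i (negbTE ns) orbF => /(_ isT).
pose f u := find (fun x => ~~ seen u x) t.
have has_f u : u \in V -> has (fun x => ~~ seen u x) t.
  move=> uV; have [i [lt_i ns _]] := guarded_attack u Ftt uV.
  by apply/hasP; exists (nth u t i) => //; rewrite mem_nth ?tk.
have f_lt u : u \in V -> f u < k by move=> uV; rewrite -tk -has_find has_f.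
exists f => [u uV|u v uV vV huv]; first exact: f_lt.
apply/eqP => fuv.
have nsu := nth_find u (has_f u uV); have nsv := nth_find u (has_f v vV); rewrite -/(f _) in nsu nsv.
have [i [lt_i ns F']] := guarded_attack u Ftt uV.
have {ns} eq_i : i = f u.
  by apply/eqP; apply: contraNT ns => neq; apply: (others u u (f u)); rewrite // f_lt.
(* Once guard [f u] has moved to [u], nobody can answer an attack on [v]: this guard is now
   [h]-adjacent to [v] and all the others are seen from [v]. *)
have [j [lt_j ns _]] := guarded_attack u F' vV.
case/negP: ns; rewrite nth_subst_nth ?tk //.
case: eqVneq => [_|neq]; first by apply: seen_h; rewrite // h_sym.
by apply: (others u v (f v)); rewrite ?f_lt // -fuv -eq_i.
Qed.

(** Guards on [J] answer no attack on [p], [q], [r], [s]. Attacking each of these four vertices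
    gives mixed pairs that cover the 4-cycle [p, r, q, s], hence contain one of its perfect
    matchings. *)
Lemma guarded_exchange J p q r s : guarded (J ++ [:: p; q]) -> guarded (J ++ [:: r; s]) ->
  all (h p) J -> all (h q) J -> all (h r) J -> all (h s) J -> h p q -> h r s ->
  guarded (J ++ [:: p; r]) && guarded (J ++ [:: q; s]) || guarded (J ++ [:: p; s]) && guarded (J ++ [:: q; r]).
Proof.
move=> F1 F2 hp hq hr hs hpq hrs.
have half a b c : guarded (J ++ [:: a; b]) -> c \in V -> all (h c) J -> guarded (J ++ [:: a; c]) || guarded (J ++ [:: b; c]).
  move=> Fab cV /allP hc; have [i [lt_i ns F']] := guarded_attack c Fab cV.
  have szJ : size J + 2 = k by rewrite -(guarded_size Fab) size_cat.
  have JV x : x \in J -> x \in V by move=> xJ; rewrite (guarded_V Fab) // mem_cat xJ.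
  have [lt_iJ|le_Ji] := ltnP i (size J).
    case/negP: ns; rewrite nth_cat lt_iJ; apply: seen_h; first by apply/JV/mem_nth.
    by apply/hc/mem_nth.
  have catS l m : subst_nth (J ++ l) (size J + m) c = J ++ subst_nth l m c.
    by elim: (J) => //= x J' ->.
  move: F'; rewrite -(subnKC le_Ji) catS.
  have : i - size J < 2 by rewrite ltn_subLR // szJ.
  case: (i - size J) => [|[|//]] _ /=; last by move->.
  by rewrite orbC; move=> F'; rewrite (guarded_perm (t := J ++ [:: c; b])) ?F' // perm_cat2l; apply/permP => P /=; rewrite addnCA.
have inV a b x : guarded (J ++ [:: a; b]) -> x \in [:: a; b] -> x \in V.
  by move=> Fab xab; rewrite (guarded_V Fab) // mem_cat xab orbT.
have comm a b : guarded (J ++ [:: a; b]) = guarded (J ++ [:: b; a]).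
  by apply: guarded_perm; rewrite perm_cat2l; apply/permP => P /=; rewrite addnCA.
have := half p q r F1 (inV _ _ _ F2 (mem_head _ _)) hr.
have := half p q s F1 (inV _ _ s F2 (mem_last r [:: s])) hs.
have := half r s p F2 (inV _ _ _ F1 (mem_head _ _)) hp.
have := half r s q F2 (inV _ _ q F1 (mem_last p [:: q])) hq.
rewrite (comm r p) (comm s p) (comm r q) (comm s q).
by do 4!case: (guarded _).
Qed.

Lemma far_seq W : {subset W <= V} -> size W < k -> exists2 v, v \in V & all (h v) W.
Proof.
move=> WV Wk; have sWV : [set x in W] \subset V by apply/subsetP => x; rewrite inE => /WV.
have [|v vV vW] := eternal_far etF sWV; first by apply: leq_ltn_trans Wk; rewrite cardsE card_size.
by exists v => //; apply/allP => x xW; rewrite h_sym vW // inE.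
Qed.

Lemma inc_of_clique b z cs : b \in V -> z \in V -> {subset cs <= V} ->
  size cs = k.-1 -> 0 < k -> all (h b) cs -> all (h z) cs -> pairwise h cs -> inc b z.
Proof.
move=> bV zV csV sz k_gt0 hb hz hcs; apply: inc_of_chain sz k_gt0 hb hz _ => //.
elim: cs csV hcs => //= x s IH sV /andP[/allP hx hs].
rewrite IH // ?andbT => [|y ys]; last by apply: sV; rewrite inE ys orbT.
by apply/allP => y ys; apply: seen_h; [apply/sV/mem_head | rewrite h_sym hx].
Qed.

(** * Two guards *)

Definition edge_in (X : {set T}) := [rel x y | [&& x \in X, y \in X & h x y]].

Lemma edge_in_sym X : connect_sym (edge_in X).
Proof. by apply: sym_connect_sym => x y /=; rewrite h_sym andbCA. Qed.

Lemma connect_closed (e : rel T) (P : T -> Prop) x y :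
  (forall u v, P u -> e u v -> P v) -> P x -> connect e x y -> P y.
Proof.
move=> cl Px /connectP[p]; elim: p x Px => /= [x Px _ -> //|z p IH x Px /andP[exz pz]].
exact: (IH z (cl _ _ Px exz)).
Qed.

(** Two neighbours of a vertex are twins by [inc_of_clique], so every other vertex of a walk from
    the root of a component is a twin of the root; the colour tells whether a vertex is such a
    twin. *)
Lemma colorable2 : k = 2 -> colorable k V.
Proof.
move=> k2; pose g := edge_in V; pose r x := root g x.
have rV x : x \in V -> r x \in V.
  move=> xV; apply: (connect_closed (e := g) (P := fun u => u \in V) _ xV); last exact: connect_root.
  by move=> u v _ /and3P[].
have near x : x \in V -> inc (r x) x \/ exists2 w, w \in V & h x w && inc (r x) w.
  move=> xV; have : connect g (r x) x by rewrite edge_in_sym connect_root.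
  apply: (connect_closed (P := fun u => inc (r x) u \/ exists2 w, w \in V & h u w && inc (r x) w));
    last by left; apply: inc_refl.
  move=> u v [iu|[w wV /andP[huw iw]]] /and3P[uV vV huv].
    by right; exists u; rewrite // h_sym huv iu.
  left; apply: inc_trans iw _ => //; apply: (inc_of_clique (cs := [:: u])) => //=; rewrite ?k2 //.
  - by move=> x'; rewrite inE => /eqP->.
  - by rewrite h_sym huw.
  - by rewrite h_sym huv.
exists (fun x => ~~ inc (r x) x : nat) => [x _|x y xV yV hxy]; first by rewrite k2; case: (~~ _).
have eq_r : r x = r y by apply/rootP; [apply: edge_in_sym | apply/connect1/and3P].
have : inc (r x) x != inc (r x) y; last by rewrite -eq_r; do 2!case: (inc _ _).
have [ix|nx] := boolP (inc (r x) x).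
  apply: contraL hxy; rewrite eq_sym eqb_id => iy; apply: inc_nh => //.
  by apply: inc_trans iy; [apply: rV | rewrite inc_sym].
have [|[w wV /andP[hxw iw]]] := near x xV; first by rewrite (negbTE nx).
suff -> : inc (r x) y by [].
apply: inc_trans iw _ => //; apply: (inc_of_clique (cs := [:: x])) => //=; rewrite ?k2 //.
- by move=> x'; rewrite inE => /eqP->.
- by rewrite h_sym hxw.
- by rewrite h_sym hxy.
Qed.

(** * Three guards *)

Section Three.
Hypothesis k3 : k = 3.

Lemma triangle_on x y : x \in V -> y \in V -> exists2 z, z \in V & h z x && h z y.
Proof.
move=> xV yV; have [||z zV] := @far_seq [:: x; y].
- by move=> u; rewrite !inE => /orP[] /eqP->.
- by rewrite k3.
by rewrite /= andbT; exists z.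
Qed.

(** Up to twins, [x] lies in a single triangle of [h]. *)
Definition simple x := [exists y in V, exists z in V,
  [&& h x y, h x z, h y z & [forall w in V, h x w ==> (inc y w || inc z w)]]].

Definition in3 x y z w := [|| inc x w, inc y w | inc z w].

Lemma in3_trans x y z u w : u \in V -> in3 x y z u -> inc u w -> in3 x y z w.
Proof.
by move=> uV /or3P[] i1 i2; apply/or3P; [constructor 1|constructor 2|constructor 3]; apply: inc_trans i2.
Qed.

(** Being adjacent, [v] and a common neighbour [c] of [u] and [v] are not twins. They therefore
    represent the two classes of neighbours of the simple vertex [u], and both lie in the three
    given classes. *)
Lemma simple_step x y z u : u \in V -> simple u -> in3 x y z u ->
  (exists v, [/\ v \in V, h u v & in3 x y z v /\ forall w, w \in V -> h v w -> in3 x y z w]) ->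
  forall w, w \in V -> h u w -> in3 x y z w.
Proof.
move=> uV /exists_inP[y' y'V /exists_inP[z' z'V /and4P[hy hz hyz /forall_inP all_u]]] iu.
case=> v [vV huv [iv all_v]] w wV huw.
have [c cV /andP[hcu hcv]] := triangle_on uV vV.
have ic : in3 x y z c by apply: all_v => //; rewrite h_sym.
have nvc : ~~ inc v c by apply: contraL hcv => ivc; rewrite h_sym inc_nh.
have := all_u v vV; have := all_u c cV; have := all_u w wV.
rewrite huw huv h_sym hcu /= => /orP iw /orP jc /orP jv.
have both d : d \in V -> inc d v -> inc d c -> False.
  by move=> dV idv idc; case/negP: nvc; apply: inc_trans idc; rewrite // inc_sym.
have via d e : d \in V -> e \in V -> in3 x y z e -> inc d e -> inc d w -> in3 x y z w.
  by move=> dV eV ie ide idw; apply: in3_trans ie _ => //; apply: inc_trans idw; rewrite // inc_sym.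
case: jc jv iw => jc [] jv [] iw; try by [case: (both y') | case: (both z')].
- exact: via cV ic jc iw.
- exact: via vV iv jv iw.
- exact: via vV iv jv iw.
- exact: via cV ic jc iw.
Qed.

(** Non-simple vertices share colour 2. By [simple_step], a component of the simple ones and its
    neighbours lie in the three classes of a triangle at the root; colours 0 and 1 separate the
    class of the root from the other two, which works unless an edge of the component avoids that
    class. *)
Lemma colorable3 :
  {in V &, forall x y, h x y -> simple x || simple y} -> colorable k V.
Proof.
move=> Dindep; pose X := [set x in V | simple x]; pose g := edge_in X; pose r x := root g x.
have good x : x \in X -> exists y z, [/\ y \in V, z \in V, [/\ r x \in X, h (r x) y, h (r x) z & h y z],
    forall w, w \in V -> h (r x) w -> in3 (r x) y z w & in3 (r x) y z x /\ forall w, w \in V -> h x w -> in3 (r x) y z w].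
  move=> xX; have rX : r x \in X.
    apply: (connect_closed (e := g) (P := fun u => u \in X) _ xX); last exact: connect_root.
    by move=> u v _ /and3P[].
  have /setIdP[rV /exists_inP[y yV /exists_inP[z zV /and4P[hy hz hyz /forall_inP all_r]]]] := rX.
  have all_r' w : w \in V -> h (r x) w -> in3 (r x) y z w.
    by move=> wV hw; have /implyP/(_ hw) := all_r w wV; rewrite /in3 => ->; rewrite orbT.
  exists y, z; split=> //.
  have : connect g (r x) x by rewrite edge_in_sym connect_root.
  apply: (connect_closed (P := fun u => in3 (r x) y z u /\ forall w, w \in V -> h u w -> in3 (r x) y z w)); last first.
    by split=> //; rewrite /in3 inc_refl.
  move=> u v [iu all_u] /and3P[]; rewrite !inE => /andP[uV _] /andP[vV sv] huv.
  have iv := all_u v vV huv; split=> //.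
  by apply: simple_step => //; exists u; rewrite h_sym.
pose f x := if simple x then ~~ inc (r x) x : nat else 2.
have [/forall_inP ok|] := boolP [forall x in X, forall y in X, h x y ==> (inc (r x) x || inc (r x) y)].
  exists f => [x _|x y xV yV hxy]; first by rewrite k3 /f; case: ifP => // _; case: (~~ _).
  rewrite /f; have := Dindep x y xV yV hxy.
  case: ifP => sx; case: ifP => sy //= _; try by case: (inc _ _).
  have xX : x \in X by rewrite inE xV.
  have yX : y \in X by rewrite inE yV.
  have eq_r : r x = r y by apply/rootP; [apply: edge_in_sym | apply/connect1/and3P].
  have := forall_inP (ok x xX) y yX; rewrite hxy -eq_r /=.
  have [y' [z' [_ _ [rX _ _ _] _ _]]] := good x xX.
  have rV : r x \in V by move: rX; rewrite inE => /andP[].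
  case ix: (inc (r x) x); case iy: (inc (r x) y) => // _; exfalso.
  by have := inc_nh xV yV (inc_trans rV (_ : inc x (r x)) iy); rewrite inc_sym ix hxy => /(_ isT).
(* In the remaining case [x] and [y] are twins of [y0] and [z0]. The neighbourhoods of the root, of
   [x] and of [y] then each miss one class of the triangle, as [colorable_of_far] requires. *)
rewrite negb_forall => /existsP[x]; rewrite negb_imply => /andP[xX].
rewrite negb_forall => /existsP[y]; rewrite !negb_imply negb_or => /and4P[yX hxy nx ny].
have [y0 [z0 [y0V z0V [rX hry hrz hyz] all_r [ix all_x]]]] := good x xX.
have eq_r : r x = r y by apply/rootP; [apply: edge_in_sym | apply/connect1/and3P].
have xV : x \in V by move: xX; rewrite inE => /andP[].
have yV : y \in V by move: yX; rewrite inE => /andP[].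
have rV : r x \in V by move: rX; rewrite inE => /andP[].
have iy := all_x y yV hxy.
have all_y : forall w, w \in V -> h y w -> in3 (r x) y0 z0 w.
  apply: simple_step => //; first by move: yX; rewrite inE => /andP[].
  by exists x; rewrite h_sym.
have excl a b w : b \in V -> a \in V -> w \in V -> h a b -> inc a w -> inc b w -> False.
  move=> bV aV wV hab iaw ibw; have := inc_nh aV bV; rewrite hab => /(_ _)/negP[] //.
  by apply: inc_trans iaw _; rewrite // inc_sym.
wlog xy : y0 z0 y0V z0V hry hrz hyz all_r ix all_x iy all_y / inc y0 x.
  move=> wl; have in3C w : in3 (r x) y0 z0 w = in3 (r x) z0 y0 w by rewrite /in3 [inc y0 w || _]orbC.
  move: (ix); rewrite /in3 (negbTE nx) /= => /orP[] ixy; first exact: (wl y0 z0).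
  apply: (wl z0 y0) => //; rewrite -?in3C //; first by rewrite h_sym.
  - by move=> w wV hrw; rewrite -in3C; apply: all_r.
  - by move=> w wV hxw; rewrite -in3C; apply: all_x.
  - by move=> w wV hyw; rewrite -in3C; apply: all_y.
have {iy ny} yz : inc z0 y.
  move: iy; rewrite /in3 (negbTE ny) /= => /orP[iy|//].
  by case: (excl x y y) => //; rewrite ?inc_refl //; apply: inc_trans iy; rewrite // inc_sym.
apply: (colorable_of_far (t := [:: r x; y0; z0])).
  apply: guarded_clique; rewrite ?k3 //= ?hry ?hrz ?hyz //.
  by move=> u; rewrite !inE => /or3P[] /eqP->.
move=> x0 i j; rewrite k3 => /andP[lt_ij lt_j].
have J1 u : u \in V -> [set u] \subset V /\ #|[set u]|.+1 < 3 by rewrite sub1set cards1.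
case: i j lt_ij lt_j => [|[|i]] [|[|[|j]]] //= _ _.
+ exists [set y]; have [-> ->] := J1 y yV; split=> // w wV /(_ y (set11 y)) hyw.
  have /or3P[->|->|izw] := all_y w wV hyw; rewrite ?orbT //.
  by case: (excl y w w) => //; [apply: inc_trans izw; rewrite // inc_sym | apply: inc_refl].
+ exists [set x]; have [-> ->] := J1 x xV; split=> // w wV /(_ x (set11 x)) hxw.
  have /or3P[->|iyw|->] := all_x w wV hxw; rewrite ?orbT //.
  by case: (excl x w w) => //; [apply: inc_trans iyw; rewrite // inc_sym | apply: inc_refl].
+ exists [set r x]; have [-> ->] := J1 (r x) rV; split=> // w wV /(_ _ (set11 _)) hrw.
  have /or3P[irw|->|->] := all_r w wV hrw; rewrite ?orbT //.
  by case: (excl (r x) w w) => //; apply: inc_refl.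
Qed.
End Three.

(** * Exchanging an edge of a [k]-clique *)

Lemma bad_pair J p q r : 1 < k -> {subset J ++ [:: p; q; r] <= V} -> size J = k.-2 ->
  pairwise h (J ++ [:: p; q]) -> all (h r) J -> ~~ inc p r -> ~~ inc q r ->
  exists x y, [/\ [/\ x \in V, y \in V, all (h x) J, all (h y) J & h x y],
    [/\ ~~ h x p, ~~ h x q, ~~ h y p & ~~ h y q],
    ~~ (inc x p && inc y q || inc x q && inc y p),
    guarded (J ++ [:: p; x]) & guarded (J ++ [:: q; y])].
Proof.
move=> k_gt1 sV szJ; rewrite pairwise_cat /= !andbT => /and3P[/allrelP pJ hJ hpq] hrJ npr nqr.
have [JV pV qV rV] : [/\ {subset J <= V}, p \in V, q \in V & r \in V].
  by split=> [x xJ|||]; apply: sV; rewrite mem_cat !inE ?xJ ?eqxx ?orbT.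
have [hpJ hqJ] : all (h p) J /\ all (h q) J.
  split; apply/allP => x xJ; rewrite h_sym.
    by apply: pJ; rewrite ?mem_head.
  by apply: pJ; rewrite ?inE ?eqxx ?orbT.
have k_gt0 : 0 < k by apply: ltnW.
have sz x : size (x :: J) = k.-1 by rewrite /= szJ; case: (k) k_gt1 => [|[]].
(* [z :: J] is a clique of size [k.-1], so its common neighbours are twins. *)
have same x y z : x \in V -> y \in V -> z \in V -> all (h x) J -> all (h y) J -> all (h z) J ->
    h x z -> h y z -> inc x y.
  move=> xV yV zV hx hy hz hxz hyz; apply: (inc_of_clique (cs := z :: J)); rewrite //= ?hxz ?hyz //.
  - by move=> u; rewrite inE => /predU1P[->|/JV].
  - exact: sz z.
  - by rewrite hz.
have rJV : {subset r :: J <= V} by move=> u; rewrite inE => /predU1P[->|/JV].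
have [|y yV /= /andP[hyr hyJ]] := far_seq rJV; first by rewrite sz prednK.
have hry : h r y by rewrite h_sym.
(* Any of these edges would make [r] a twin of [p] or of [q]. *)
have [n1 n2 n3 n4] : [/\ ~~ h r p, ~~ h r q, ~~ h y p & ~~ h y q].
  split; apply/negP => hh.
  - by case/negP: nqr; apply: (same q r p); rewrite // h_sym.
  - by case/negP: npr; apply: (same p r q).
  - by case/negP: npr; apply: (same p r y); rewrite // h_sym.
  - by case/negP: nqr; apply: (same q r y); rewrite // h_sym.
have clq x z : x \in V -> z \in V -> all (h x) J -> all (h z) J -> h x z -> guarded (J ++ [:: x; z]).
  move=> xV zV hx hz hxz; apply: guarded_clique.
  - by move=> u; rewrite mem_cat !inE => /or3P[/JV|/eqP->|/eqP->].
  - by rewrite size_cat /= szJ addn2; case: (k) k_gt1 => [|[]].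
  - rewrite pairwise_cat hJ /= hxz !andbT; apply/allrelP => u v uJ.
    by rewrite !inE h_sym => /orP[] /eqP->; [apply: (allP hx) | apply: (allP hz)].
(* The matching obtained decides which of [r] and [y] plays the role of [x]. *)
have := guarded_exchange (clq _ _ pV qV hpJ hqJ hpq) (clq _ _ rV yV hrJ hyJ hry) hpJ hqJ hrJ hyJ hpq hry.
case/orP => /andP[F1 F2].
  exists r, y; split=> //.
  by rewrite ![inc r _]inc_sym (negbTE npr) (negbTE nqr).
exists y, r; split=> //.
by rewrite ![inc r _]inc_sym (negbTE npr) (negbTE nqr) !andbF.
Qed.

(** In a [k]-clique, [colorable_of_far] is tried with [J] the clique without [p] and [q]; for this
    [J] it fails exactly when some common neighbour [r] of [J] is a twin of neither. *)
Lemma bad_clique : 1 < k -> colorable k V \/ exists J p q r,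
  [/\ {subset J ++ [:: p; q; r] <= V}, size J = k.-2, pairwise h (J ++ [:: p; q]), all (h r) J &
      ~~ inc p r /\ ~~ inc q r].
Proof.
move=> k_gt1; have c0 : is_clique set0 by move=> x y; rewrite inE.
have [|K [_ KV Kc Kk]] := clique_extend (eternal_far etF) (sub0set V) c0; first by rewrite cards0.
have cardJ p q : p \in K -> q \in K -> p != q -> #|K :\ p :\ q| = k.-2.
  move=> pK qK neq; have := cardsD1 q (K :\ p); have := cardsD1 p K.
  by rewrite pK !inE eq_sym neq qK Kk => -> ->.
have [/exists_inP[p pK]|no] := boolP [exists p in K, exists q in K, exists r in V,
    [&& p != q, [forall x in K :\ p :\ q, h x r], ~~ inc p r & ~~ inc q r]].
  case/exists_inP => q qK /exists_inP[r rV /and4P[neq /forall_inP hJ np nq]]; right.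
  have JK x : x \in enum (K :\ p :\ q) -> [/\ x \in K, x != p & x != q].
    by rewrite mem_enum !inE => /and3P[].
  exists (enum (K :\ p :\ q)), p, q, r; split=> //.
  - move=> x; rewrite mem_cat !inE => /or4P[/JK[xK _ _]|/eqP->|/eqP->|/eqP-> //]; exact: (subsetP KV).
  - by rewrite -cardE cardJ.
  - have UJ : uniq (enum (K :\ p :\ q) ++ [:: p; q]).
      rewrite cat_uniq enum_uniq /= inE neq orbF !mem_enum !inE !eqxx /= andbF.
      by rewrite orbF.
    have sK : {subset enum (K :\ p :\ q) ++ [:: p; q] <= K}.
      by move=> x; rewrite mem_cat !inE => /or3P[/JK[]|/eqP->|/eqP->].
    elim: (_ ++ _) UJ sK => //= x s IH /andP[xs Us] sK.
    rewrite IH // ?andbT => [|y ys]; last by apply: sK; rewrite inE ys orbT.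
    apply/allP => y ys; apply: Kc; rewrite ?sK ?mem_head ?inE ?ys ?orbT //.
    by apply: contraNneq xs => ->.
  - by apply/allP => x; rewrite mem_enum h_sym => /hJ.
left; have FK : K \in F by apply: clique_guarded.
have szK : size (enum K) = k by rewrite -cardE.
apply: (colorable_of_far (guarded_enum FK)) => x0 i j /andP[lt_ij lt_j].
have lt_i := ltn_trans lt_ij lt_j.
set p := nth x0 _ i; set q := nth x0 _ j.
have pK : p \in K by rewrite -mem_enum mem_nth ?szK.
have qK : q \in K by rewrite -mem_enum mem_nth ?szK.
have neq : p != q by rewrite nth_uniq ?szK ?enum_uniq // neq_ltn lt_ij.
exists (K :\ p :\ q); split.
- by apply: subset_trans KV; rewrite !subDset !subsetU ?subxx ?orbT.
- by rewrite cardJ //; case: (k) k_gt1 => [|[|m]] //=.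
- move=> w wV hw; apply: contraNT no; rewrite negb_or => /andP[np nq].
  apply/exists_inP; exists p => //; apply/exists_inP; exists q => //; apply/exists_inP; exists w => //.
  by rewrite neq np nq !andbT; apply/forall_inP.
Qed.
End Classes.
End Guards.

(** * Certificates and their verification *)

(** Bits indexed by labels. The operations are meant for call-by-value evaluation, hence the [if] in
    place of [&&] before recursive calls. *)
Definition row := seq bool.

Fixpoint band (a b : row) : row :=
  if a is x :: a' then if b is y :: b' then (x && y) :: band a' b' else [::] else [::].
Fixpoint bor (a b : row) : row :=
  if a is x :: a' then if b is y :: b' then (x || y) :: bor a' b' else a else b.
Fixpoint meets (a b : row) : bool :=
  if a is x :: a' then if b is y :: b' then if x && y then true else meets a' b' else false else false.
Fixpoint allb (a : row) : bool := if a is x :: a' then if x then allb a' else false else true.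
Fixpoint setb (a : row) (i : nat) : row :=
  match a, i with
  | [::], _ => [::]
  | x :: a', O => true :: a'
  | x :: a', S i' => x :: setb a' i'
  end.
Fixpoint updr (M : seq row) (i : nat) (f : row -> row) : seq row :=
  match M, i with
  | [::], _ => [::]
  | r :: M', O => f r :: M'
  | r :: M', S i' => r :: updr M' i' f
  end.
Fixpoint nget (T : Type) (d : T) (s : seq T) (i : nat) : T :=
  match s, i with
  | [::], _ => d
  | x :: _, O => x
  | _ :: s', S i' => nget d s' i'
  end.
Definition get (M : seq row) i := nget [::] M i.
Definition bit (M : seq row) i j := nget false (get M i) j.
Definition set2 (M : seq row) i j :=
  updr (updr M i (fun r => setb r j)) j (fun r => setb r i).
Fixpoint eqsn (s t : seq nat) : bool :=
  match s, t with
  | [::], [::] => true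
  | x :: s', y :: t' => if eqn x y then eqsn s' t' else false
  | _, _ => false
  end.

(* What is known about the graph, on vertices labelled from [0]: edges and non-edges
   of [h], the relation [inc], and positions (as lists, up to [inc]). *)
Record state := St { adj : seq row; non : seq row; cls : seq row; pos : seq (seq nat) }.
(* [cn] vertices, [ck] guards; the first [cnb] labels form the initial configuration
   and the others are sorted by decreasing adjacency to it. A quadruple [(p, q, x, y)]
   of [cpairs] records that [x], [y] are not respective twins of [p], [q] in any order. *)
Record ctx := Ctx { cn : nat; ck : nat; cnb : nat; cpairs : seq (nat * nat * nat * nat) }.

Definition addA st i j := St (set2 (adj st) i j) (non st) (cls st) (pos st).
Definition addN st i j := St (adj st) (set2 (non st) i j) (cls st) (pos st).
Definition addP st t := St (adj st) (non st) (cls st) (t :: pos st).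
(** Each member of the merged class stores the whole class, since [sees] reads the row of a single
    member. *)
Definition merge_rows (M : seq row) (u : row) : seq row :=
  (fix go (M : seq row) (v : row) {struct M} : seq row :=
     match M, v with
     | r :: M', b :: v' => (if b then u else r) :: go M' v'
     | _, _ => M
     end) M u.
Definition merge st b z :=
  St (adj st) (non st) (merge_rows (cls st) (bor (get (cls st) b) (get (cls st) z))) (pos st).

Definition sees st u x := meets (get (adj st) u) (get (cls st) x).
Definition memP st t := has (eqsn t) (pos st).
Definition distinctP st t := pairwise (fun a b => ~~ bit (cls st) a b) t.

(* Contradictions: adjacent twins; twins in a position; attack on [w] that no guard of
   the position [t] can answer, where [us] lists for each guard a vertex that cannot be
   defended after its move; less than [ck] vertices with no common neighbour; dominated
   vertex; violation of [cpairs]; violation of the order of the labels. *)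
Inductive reason :=
| RCls of nat & nat
| REq of seq nat
| RAtt of seq nat & nat & seq nat
| RS1 of seq nat
| RDom of nat & nat
| RPair
| RSym of nat & nat.

Notation replace := (@subst_nth nat).
Definition blocked st t w i u :=
  if sees st w (nget 0 t i) then true
  else let t' := replace t i w in
       (* A position with two twins is impossible, which excludes the move whatever [u] is. *)
       if distinctP st t' then all (sees st u) t' else true.

Definition fullrow n (r : row) := eqn (size r) n && allb r.
(** The codes are known to agree before [j], where only the second has an edge: they increase,
    against the order of the labels. *)
Fixpoint sym_pre (a n a' n' : row) (j : nat) : bool :=
  match a, n, a', n', j with
  | _ :: _, x :: _, y :: _, _ :: _, O => x && y
  | x :: a, y :: n, x' :: a', y' :: n', S j =>
     if (x && x') || (y && y') then sym_pre a n a' n' j else false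
  | _, _, _, _, _ => false
  end.

Definition refutes (c : ctx) st r : bool :=
  match r with
  | RCls i j => bit (adj st) i j && bit (cls st) i j
  | REq t => memP st t && ~~ distinctP st t
  | RAtt t w us => memP st t && all (fun i => blocked st t w i (nget 0 us i)) (iota 0 (ck c))
  | RS1 W => (size W < ck c) && fullrow (cn c) (foldr (fun i r => bor (get (non st) i) r) [::] W)
  | RDom x y => [&& ~~ eqn x y, x < cn c, y < cn c & fullrow (cn c) (bor (get (non st) x) (get (adj st) y))]
  | RPair => has (fun '(p, q, x, y) => (bit (cls st) x p && bit (cls st) y q)
                                   || (bit (cls st) x q && bit (cls st) y p)) (cpairs c)
  | RSym z j => [&& cnb c <= z, z.+1 < cn c, j < cnb c
                  & sym_pre (get (adj st) z) (get (non st) z) (get (adj st) z.+1) (get (non st) z.+1) j]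
  end.

(* Deductions: edge, non-edge (the opposite being refuted), [inc_of_chain], clique, move
   of the only guard able to answer an attack. *)
Inductive step :=
| SA of nat & nat & reason
| SN of nat & nat & reason
| SM of nat & nat & seq nat
| SC of seq nat
| SP of seq nat & nat & nat & seq nat.

Definition valid (c : ctx) st s : bool :=
  match s with
  | SA i j r => refutes c (addN st i j) r
  | SN i j r => refutes c (addA st i j) r
  | SM b z cs => [&& eqn (size cs).+1 (ck c), all (bit (adj st) b) cs, all (bit (adj st) z) cs
                   & pairwise (fun x y => sees st y x) cs]
  | SC t => eqn (size t) (ck c) && pairwise (bit (adj st)) t
  | SP t w m us => memP st t && all (fun i => eqn i m || blocked st t w i (nget 0 us i)) (iota 0 (ck c))
  end.
Definition apply st s : state :=
  match s with
  | SA i j _ => addA st i j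
  | SN i j _ => addN st i j
  | SM b z _ => merge st b z
  | SC t => addP st t
  | SP t w m _ => addP st (replace t m w)
  end.

Inductive cert :=
| Leaf of reason
| Col of seq row
| Step of step & cert
| Br of nat & nat & cert & cert.

Fixpoint subrow (a b : row) : bool :=
  match a, b with
  | [::], _ => true
  | x :: a', y :: b' => if x then if y then subrow a' b' else false else subrow a' b'
  | x :: a', [::] => if x then false else subrow a' [::]
  end.
Definition col_ok (c : ctx) st (ms : seq row) : bool :=
  [&& size ms <= ck c, fullrow (cn c) (foldr bor [::] ms)
    & all (fun m => all (fun i => if nget false m i then subrow m (get (non st) i) else true) (iota 0 (cn c))) ms].

Fixpoint check (c : ctx) (p : cert) (st : state) : bool :=
  match p with
  | Leaf r => refutes c st r
  | Col ms => col_ok c st ms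
  | Step s p' => if valid c st s then check c p' (apply st s) else false
  | Br i j p1 p0 => if check c p1 (addA st i j) then check c p0 (addN st i j) else false
  end.

(** The diagonal records that a vertex is non-adjacent to itself and is its own twin. *)
Definition empty (n : nat) : state :=
  let d := map (fun i => map (fun j => eqn i j) (iota 0 n)) (iota 0 n) in
  St (nseq n (nseq n false)) d d [::].
Definition mkst n (es ns : seq (nat * nat)) (ps : seq (seq nat)) : state :=
  foldr (fun t s => addP s t)
   (foldr (fun e s => addN s e.1 e.2) (foldr (fun e s => addA s e.1 e.2) (empty n) es) ns) ps.
(** Labels 0, 1, 2 form a triangle in which 0 and 1 are not simple; [bad_pair] yields 3, 4 from [J =
    [:: 0]] and 5, 6 from [J = [:: 1]]. *)
Definition edges3 := [:: (0,1);(0,2);(1,2);(0,3);(0,4);(3,4);(1,5);(1,6);(5,6)].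
Definition nonedges3 := [:: (3,1);(3,2);(4,1);(4,2);(5,0);(5,2);(6,0);(6,2)].
Definition positions3 := [:: [:: 0;1;3]; [:: 0;2;4]; [:: 0;1;5]; [:: 1;2;6]].
Definition pairs3 := [:: (1,2,3,4); (0,2,5,6)].
Definition base3 n := mkst n edges3 nonedges3 positions3.
Definition ctx3 n := Ctx n 3 7 pairs3.

(** Labels below [k-2] form [J]; then come [p], [q], [x], [y] of [bad_pair]. *)
Definition edgesK k := (k-2, k-1) :: (k, k.+1) ::
  flatten [seq [seq (i, j) | j <- iota i.+1 (k.+1 - i)] | i <- iota 0 (k-2)].
Definition nonedgesK k := [:: (k-2,k); (k-2,k.+1); (k-1,k); (k-1,k.+1)].
Definition positionsK k := [:: iota 0 (k-2) ++ [:: k-2; k]; iota 0 (k-2) ++ [:: k-1; k.+1]].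
Definition pairsK k := [:: (k-2,k-1,k,k.+1)].
Definition baseK k n := mkst n (edgesK k) (nonedgesK k) (positionsK k).
Definition ctxK k n := Ctx n k k.+2 (pairsK k).

(** * Soundness of the checker *)

Lemma nget_nth (T : Type) (d : T) s i : nget d s i = nth d s i.
Proof. by elim: s i => [|x s IH] [|i] /=. Qed.

Lemma nth_bor a b i : nth false (bor a b) i = nth false a i || nth false b i.
Proof. by elim: a b i => [|x a IH] [|y b] [|i] //=; rewrite ?nth_nil ?orbF. Qed.

Lemma meetsP a b : meets a b -> exists2 i, nth false a i & nth false b i.
Proof.
elim: a b => [|x a IH] [|y b] //=; case: ifP => [/andP[hx hy] _|_ /IH[i hi hi']].
  by exists 0.
by exists i.+1.
Qed.

Lemma nth_setb a i j : nth false (setb a i) j -> nth false a j \/ j = i.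
Proof. by elim: a i j => [|x a IH] [|i] [|j] //=; auto => /IH[|->]; auto. Qed.

Lemma nth_updr M i f j : nth [::] (updr M i f) j = nth [::] M j \/
  j = i /\ nth [::] (updr M i f) j = f (nth [::] M j).
Proof. by elim: M i j => [|r M IH] [|i] [|j] //=; auto; case: (IH i j) => [|[-> ?]]; auto. Qed.

Lemma bitE M i j : bit M i j = nth false (nth [::] M i) j.
Proof. by rewrite /bit /get !nget_nth. Qed.

Lemma bit_set2 M i j a b : bit (set2 M i j) a b ->
  [\/ bit M a b, (a, b) = (i, j) | (a, b) = (j, i)].
Proof.
rewrite !bitE /set2; case: (nth_updr (updr M i (fun r => setb r j)) j (fun r => setb r i) a) => [|[-> ]] ->.
  case: (nth_updr M i (fun r => setb r j) a) => [|[-> ]] ->; first by constructor 1.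
  by case/nth_setb => [|->]; [constructor 1 | constructor 2].
case/nth_setb => [|->]; last by constructor 3.
case: (nth_updr M i (fun r => setb r j) j) => [|[-> ]] ->; first by constructor 1.
by case/nth_setb => [|->]; [constructor 1 | constructor 2].
Qed.

Lemma fullrowP n r : fullrow n r -> forall i, i < n -> nth false r i.
Proof.
case/andP => /eqnP <- {n}; elim: r => //= x r IH; case: x => // /IH{}IH [|i] //=.
exact: IH.
Qed.

Lemma nth_foldr_bor (T : Type) (f : T -> row) (s : seq T) i :
  nth false (foldr (fun x r => bor (f x) r) [::] s) i = has (fun x => nth false (f x) i) s.
Proof. by elim: s => [|x s IH] /=; rewrite ?nth_nil // nth_bor IH. Qed.

Lemma nth_subrow a b i : subrow a b -> nth false a i -> nth false b i.
Proof.
elim: a b i => [|x a IH] [|y b] [|i] //=; case: x => //.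
- by move=> /IH{}IH /IH; rewrite nth_nil.
- by case: y.
- by case: y => // /IH; apply.
- by move=> /IH; apply.
Qed.

Lemma nth_merge_rows M u i : nth [::] (merge_rows M u) i =
  if (i < size M) && nth false u i then u else nth [::] M i.
Proof.
rewrite /merge_rows; move: {2 3}u => v; elim: M v i => [|r M IH] v i.
  by case: v => [|b v] /=; rewrite ?nth_nil.
case: v => [|b v]; first by rewrite ?nth_nil andbF.
by case: i => [|i] //=; rewrite ?IH //; case: b.
Qed.

Lemma eqsnP s t : eqsn s t -> s = t.
Proof. by elim: s t => [|x s IH] [|y t] //=; case: ifP => // /eqnP-> /IH->. Qed.

Fixpoint lex_le (a b : seq bool) : bool :=
  match a, b with
  | x :: a', y :: b' => if x == y then lex_le a' b' else y
  | _, _ => true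
  end.

Lemma lex_le_total : total lex_le.
Proof. by elim=> [|x a IH] [|y b] //=; case: x y => [] [] //=; apply: IH. Qed.

Section Soundness.
Variables (T : finType) (h : rel T).
Hypotheses (h_sym : symmetric h) (h_irr : irreflexive h).
Variables (V : {set T}) (F : {set {set T}}) (c : ctx).
Let k := ck c.
Let n := cn c.
Hypothesis etF : eternal h k V F.
Hypothesis dom_free : forall x y, x \in V -> y \in V -> x != y ->
  exists2 w, w \in V & h x w && ~~ h y w.
Variables (x0 : T) (l : seq T).
Hypotheses (x0V : x0 \in V) (lV : l =i V) (Ul : uniq l) (sz_l : size l = n).
Local Notation lab := (nth x0 l).
Local Notation inc := (inc F).
Hypothesis pairs_ok : forall p q x y, (p, q, x, y) \in cpairs c ->
  ~~ (inc (lab x) (lab p) && inc (lab y) (lab q) || inc (lab x) (lab q) && inc (lab y) (lab p)).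
Definition code w := [seq h w (lab j) | j <- iota 0 (cnb c)].
Hypothesis sym_ok : forall z, cnb c <= z -> z.+1 < n -> lex_le (code (lab z.+1)) (code (lab z)).

Record sat (s : state) : Prop := Sat {
  sat_adj : forall i j, bit (adj s) i j -> h (lab i) (lab j);
  sat_non : forall i j, bit (non s) i j -> ~~ h (lab i) (lab j);
  sat_cls : forall i j, bit (cls s) i j -> inc (lab i) (lab j);
  sat_pos : forall t, memP s t -> guarded k F (map lab t) }.

Lemma labV i : lab i \in V.
Proof.
have [lt|le] := ltnP i (size l); first by rewrite -lV mem_nth.
by rewrite nth_default.
Qed.

Lemma index_lab v : v \in V -> exists2 i, i < n & v = lab i.
Proof. by rewrite -lV => vl; exists (index v l); rewrite ?nth_index // -sz_l index_mem. Qed.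

Lemma sat_sees s u x : sat s -> sees s u x -> seen h V F (lab u) (lab x).
Proof.
move=> ss /meetsP[j]; rewrite /get !nget_nth -!bitE => /(sat_adj ss) hj /(sat_cls ss) ij.
by apply/exists_inP; exists (lab j); rewrite ?labV ?ij.
Qed.

Lemma map_lab_replace t i w : map lab (replace t i w) = subst_nth (map lab t) i (lab w).
Proof. exact: map_subst_nth. Qed.

Lemma guarded_pairwise s t : sat s -> guarded k F (map lab t) -> distinctP s t.
Proof.
move=> ss guarded_t; have := guarded_dist guarded_t; rewrite pairwise_map.
by apply: sub_pairwise => i j /=; apply: contra => /(sat_cls ss).
Qed.

Lemma all_seen t w : guarded k F (map lab t) -> w \in V ->
  all (fun i => seen h V F w (lab i)) t -> False.
Proof.
move=> guarded_t wV /allP seen_t; have [i [lt_i ns _]] := guarded_attack h_sym h_irr etF x0 guarded_t wV.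
have szt : size t = k by rewrite -(guarded_size guarded_t) size_map.
by case/negP: ns; rewrite (nth_map 0) ?szt // seen_t // mem_nth ?szt.
Qed.

Lemma not_blocked s t w i u : sat s -> size t = k -> i < k ->
  ~~ seen h V F (lab w) (nth x0 (map lab t) i) -> guarded k F (subst_nth (map lab t) i (lab w)) ->
  ~~ blocked s t w i u.
Proof.
move=> ss szt lt_i ns; rewrite -map_lab_replace => guarded_t'; rewrite /blocked.
rewrite (guarded_pairwise ss guarded_t') nget_nth.
case: ifP => [/(sat_sees ss)|_]; first by rewrite -(nth_map _ x0) ?szt // (negbTE ns).
apply/negP => /allP seen_t'; apply: (all_seen guarded_t' (labV u)).
by apply/allP => j /seen_t'; apply: sat_sees.
Qed.

Lemma attack_pos s t w : sat s -> memP s t ->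
  exists i, [/\ i < k, forall u, ~~ blocked s t w i u & guarded k F (map lab (replace t i w))].
Proof.
move=> ss /(sat_pos ss) guarded_t; have szt : size t = k by rewrite -(guarded_size guarded_t) size_map.
have [i [lt_i ns F']] := guarded_attack h_sym h_irr etF x0 guarded_t (labV w).
by exists i; split=> // [u|]; [apply: not_blocked | rewrite map_lab_replace].
Qed.

Lemma sym_preP s z z' j : sat s ->
  sym_pre (get (adj s) z) (get (non s) z) (get (adj s) z') (get (non s) z') j ->
  (forall i, i < j -> h (lab z) (lab i) = h (lab z') (lab i)) /\
  ~~ h (lab z) (lab j) /\ h (lab z') (lab j).
Proof.
move=> ss.
have H M w : exists r, get M w = r /\ forall i, bit M w i = nth false r i.
  by exists (get M w); split=> // i; rewrite /bit nget_nth.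
have aux m a b a' b' :
  (forall i, nth false a i -> h (lab z) (lab (m + i))) ->
  (forall i, nth false b i -> ~~ h (lab z) (lab (m + i))) ->
  (forall i, nth false a' i -> h (lab z') (lab (m + i))) ->
  (forall i, nth false b' i -> ~~ h (lab z') (lab (m + i))) ->
  sym_pre a b a' b' j ->
  (forall i, i < j -> h (lab z) (lab (m + i)) = h (lab z') (lab (m + i))) /\
  ~~ h (lab z) (lab (m + j)) /\ h (lab z') (lab (m + j)).
  elim: j m a b a' b' => [|j IH] m [|x a] [|y b] [|x' a'] [|y' b'] //= ha hb ha' hb'.
    by case/andP => /(hb 0) ? /(ha' 0) ?.
  case: ifP => // eq0 /(IH m.+1)[].
  - by move=> i /(ha i.+1); rewrite addSnnS.
  - by move=> i /(hb i.+1); rewrite addSnnS.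
  - by move=> i /(ha' i.+1); rewrite addSnnS.
  - by move=> i /(hb' i.+1); rewrite addSnnS.
  move=> pre; rewrite addSnnS => post; split=> // -[_|i /pre]; last by rewrite addSnnS.
  case/orP: eq0 => /andP[]; first by move=> /(ha 0) -> /(ha' 0) ->.
  by move=> /(hb 0)/negbTE-> /(hb' 0)/negbTE->.
apply: (aux 0) => i; rewrite /get !nget_nth -bitE => /=.
- exact: sat_adj.
- exact: sat_non.
- exact: sat_adj.
- exact: sat_non.
Qed.

Lemma refutes_sound s r : sat s -> refutes c s r -> False.
Proof.
move=> ss; case: r => [i j|t|t w us|W|x y||z j] /=.
- case/andP => /(sat_adj ss) hij /(sat_cls ss) iij.
  by have := inc_nh h_irr etF (labV i) (labV j) iij; rewrite hij.
- by case/andP => /(sat_pos ss)/(guarded_pairwise ss)->.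
- case/andP => t_in /allP all_b; have [i [lt_i nb _]] := attack_pos w ss t_in.
  by have := all_b i; rewrite mem_iota (negbTE (nb _)) => /(_ lt_i).
- case/andP => szW /fullrowP full.
  have WV : {subset map lab W <= V} by move=> _ /mapP[i _ ->]; apply: labV.
  have [|v vV] := far_seq h_sym etF WV; first by rewrite size_map.
  have [w lt_w ->] := index_lab vV; rewrite all_map => /allP all_h.
  have := full w lt_w; rewrite nth_foldr_bor => /hasP[i iW]; rewrite /get nget_nth -bitE.
  by have := all_h i iW; rewrite /= h_sym => hh /(sat_non ss)/negP[].
- case/and4P => /eqnP neq lt_x lt_y /fullrowP full.
  have [|w wV] := dom_free (labV x) (labV y).
    by rewrite nth_uniq ?sz_l //; apply/eqP.
  have [i lt_i -> /andP[hxi nhyi]] := index_lab wV.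
  have := full i lt_i; rewrite nth_bor /get !nget_nth -!bitE => /orP[/(sat_non ss)|/(sat_adj ss)].
    by rewrite hxi.
  by rewrite (negbTE nhyi).
- case/hasP => -[[[p q] x] y] /pairs_ok/negP no b; apply: no.
  by apply/orP; case/orP: b => /andP[/(sat_cls ss) -> /(sat_cls ss) ->]; [left | right].
- case/and4P => le_z lt_z lt_j /(sym_preP ss)[pre [nz hz]].
  have := sym_ok le_z lt_z; rewrite /code.
  have -> : iota 0 (cnb c) = iota 0 j ++ j :: iota j.+1 (cnb c - j.+1).
    by rewrite -[X in iota 0 X = _](subnKC lt_j) addSnnS iotaD /= add0n.
  rewrite !map_cat /= (negbTE nz) hz.
  have -> : [seq h (lab z.+1) (lab i) | i <- iota 0 j] = [seq h (lab z) (lab i) | i <- iota 0 j].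
    by apply/eq_in_map => i; rewrite mem_iota => /pre.
  by elim: map => //= b s1 IH; rewrite eqxx.
Qed.

Lemma sat_addA s i j : sat s -> h (lab i) (lab j) -> sat (addA s i j).
Proof.
case=> sa sn sc sp hij; split=> // a b /bit_set2[/sa|[-> ->]|[-> ->]] //.
by rewrite h_sym.
Qed.

Lemma sat_addN s i j : sat s -> ~~ h (lab i) (lab j) -> sat (addN s i j).
Proof.
case=> sa sn sc sp hij; split=> // a b /bit_set2[/sn|[-> ->]|[-> ->]] //.
by rewrite h_sym.
Qed.

Lemma sat_addP s t : sat s -> guarded k F (map lab t) -> sat (addP s t).
Proof. by case=> sa sn sc sp guarded_t; split=> // t' /orP[/eqsnP->|/sp]. Qed.

Lemma sat_merge s b z : sat s -> inc (lab b) (lab z) -> sat (merge s b z).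
Proof.
move=> ss ibz; have [sa sn sc sp] := ss; split=> // i j.
rewrite bitE /= nth_merge_rows; case: ifP => [/andP[_]|_]; last by rewrite -bitE => /sc.
have all_b m : nth false (bor (get (cls s) b) (get (cls s) z)) m -> inc (lab b) (lab m).
  rewrite nth_bor /get !nget_nth -!bitE => /orP[/sc //|/sc].
  exact: (inc_trans h_irr etF (labV z) ibz).
move=> /all_b bi /all_b bj; apply: (inc_trans h_irr etF (labV b)) bj.
by rewrite inc_sym.
Qed.

Lemma apply_sound s st : sat s -> valid c s st -> sat (apply s st).
Proof.
move=> ss; case: st => [i j r|i j r|b z cs|t|t w m us] /=.
- move=> ref; apply: sat_addA => //; apply/negPn/negP => nh.
  exact: refutes_sound (sat_addN ss nh) ref.
- move=> ref; apply: sat_addN => //; apply/negP => hij.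
  exact: refutes_sound (sat_addA ss hij) ref.
- case/and4P => /eqnP sz /allP hb /allP hz hcs; apply: sat_merge => //.
  have sz' : size (map lab cs) = k.-1 by rewrite size_map -[k]sz.
  have k_gt0 : 0 < k by rewrite -[k]sz.
  apply: (inc_of_chain h_sym h_irr etF (labV b) (labV z) _ sz' k_gt0).
  + by move=> _ /mapP[i _ ->]; apply: labV.
  + by rewrite all_map; apply/allP => i /hb /(sat_adj ss).
  + by rewrite all_map; apply/allP => i /hz /(sat_adj ss).
  + by rewrite pairwise_map; apply: sub_pairwise hcs => i j /= /(sat_sees ss).
- case/andP => /eqnP szt ht; apply: sat_addP => //.
  apply: (guarded_clique h_sym h_irr etF); first by move=> _ /mapP[i _ ->]; apply: labV.
    by rewrite size_map.
  by rewrite pairwise_map; apply: sub_pairwise ht => i j /= /(sat_adj ss).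
- case/andP => t_in /allP all_b; apply: sat_addP => //.
  have [i [lt_i nb F']] := attack_pos w ss t_in.
  by have := all_b i; rewrite mem_iota (negbTE (nb _)) orbF => /(_ lt_i)/eqnP <-.
Qed.

Lemma col_ok_sound s ms : sat s -> col_ok c s ms -> colorable h k V.
Proof.
move=> ss /and3P[szm /fullrowP full /allP ok].
(* The colour classes may overlap: a vertex takes the first one containing it. *)
pose f x := find (fun m => nth false m (index x l)) ms.
have has_f x : x \in V -> has (fun m => nth false m (index x l)) ms.
  rewrite -lV -index_mem sz_l => /full; rewrite -[ms in foldr _ _ ms]map_id foldr_map.
  by rewrite (nth_foldr_bor id).
exists f => [x xV|x y xV yV hxy]; first by apply: leq_trans szm; rewrite -has_find has_f.
apply/eqP => fxy; have := nth_find [::] (has_f y yV); have := nth_find [::] (has_f x xV).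
rewrite -/(f x) -/(f y) -fxy; set m := nth [::] ms _ => mx my.
have m_in : m \in ms by apply: mem_nth; rewrite -has_find has_f.
have /allP/(_ (index x l)) := ok m m_in.
rewrite mem_iota /= add0n -[cn c]sz_l index_mem lV xV => /(_ isT).
rewrite nget_nth mx => /nth_subrow/(_ my).
rewrite /get nget_nth -bitE => /(sat_non ss).
by rewrite !nth_index ?lV // hxy.
Qed.

Lemma check_sound p s : sat s -> check c p s -> colorable h k V.
Proof.
elim: p s => [r|ms|st p IH|i j p1 IH1 p0 IH0] s ss /=.
- by move/(refutes_sound ss).
- exact: col_ok_sound.
- by case: ifP => // /(apply_sound ss); apply: IH.
- case: ifP => // ok1 ok0; have [hij|nh] := boolP (h (lab i) (lab j)).
    exact: IH1 (sat_addA ss hij) ok1.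
  exact: IH0 (sat_addN ss nh) ok0.
Qed.

Lemma mkst_sat es ns ps :
  all (fun e => h (lab e.1) (lab e.2)) es ->
  all (fun e => ~~ h (lab e.1) (lab e.2)) ns ->
  all (fun t => guarded k F (map lab t)) ps -> sat (mkst n es ns ps).
Proof.
move=> he hn hp.
have s0 : sat (empty n).
  have diag i j : bit (map (fun i => map (fun j => eqn i j) (iota 0 n)) (iota 0 n)) i j -> i = j.
    rewrite bitE; have [lt_i|le_i] := ltnP i n; last by rewrite [nth [::] _ _]nth_default ?nth_nil ?size_map ?size_iota.
    rewrite (nth_map 0) ?size_iota // nth_iota // add0n.
    have [lt_j|le_j] := ltnP j n; last by rewrite nth_default ?size_map ?size_iota.
    by rewrite (nth_map 0) ?size_iota // nth_iota // add0n => /eqnP.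
  split=> //= i j.
  - rewrite bitE; have [lt_i|le_i] := ltnP i n; last by rewrite [nth [::] _ _]nth_default ?nth_nil ?size_nseq.
    by rewrite nth_nseq lt_i nth_nseq; case: ifP.
  - by move/diag => ->; rewrite h_irr.
  - by move/diag => ->; apply: inc_refl.
rewrite /mkst; elim: ps hp => [_|t ps IH /= /andP[guarded_t /IH ss]]; last exact: sat_addP.
elim: ns hn => [_|e ns IH /= /andP[nh /IH ss]]; last exact: sat_addN.
by elim: es he => [_ //|e es IH /= /andP[he /IH ss]]; apply: sat_addA.
Qed.
End Soundness.

(** * Configurations contained in a counterexample *)

Section Bases.
Variables (T : finType) (h : rel T).
Hypotheses (h_sym : symmetric h) (h_irr : irreflexive h).
Variables (k : nat) (V : {set T}) (F : {set {set T}}).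
Hypothesis etF : eternal h k V F.
Hypothesis dom_free : forall x y, x \in V -> y \in V -> x != y ->
  exists2 w, w \in V & h x w && ~~ h y w.

(** The hypothesis quantifies over [rest] because the other vertices are ordered only in the proof,
    by decreasing adjacency to [lb], which is what justifies [RSym]. *)
Lemma colorable_of_base (x0 : T) (lb : seq T) pairs es ns ps :
  x0 \in V -> uniq lb -> {subset lb <= V} ->
  (forall rest, let lab := nth x0 (lb ++ rest) in
    [/\ all (fun e => h (lab e.1) (lab e.2)) es,
        all (fun e => ~~ h (lab e.1) (lab e.2)) ns,
        all (fun t => guarded k F (map lab t)) ps &
        forall p q x y, (p, q, x, y) \in pairs ->
          ~~ (inc F (lab x) (lab p) && inc F (lab y) (lab q) ||
              inc F (lab x) (lab q) && inc F (lab y) (lab p))]) ->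
  (size lb <= #|V| -> exists p, check (Ctx #|V| k (size lb) pairs) p (mkst #|V| es ns ps)) ->
  colorable h k V.
Proof.
move=> x0V Ulb lbV ok certs.
pose S := V :\: [set x in lb].
pose cd w := [seq h w (nth x0 lb j) | j <- iota 0 (size lb)].
pose le x y := lex_le (cd y) (cd x).
pose rest := sort le (enum S); pose l := lb ++ rest.
have rest_S : rest =i S by move=> x; rewrite mem_sort mem_enum.
have lV : l =i V.
  move=> x; rewrite mem_cat rest_S !inE; have [/lbV ->|] //= := boolP (x \in lb).
have Ul : uniq l.
  rewrite cat_uniq Ulb sort_uniq enum_uniq andbT /=.
  by apply/hasPn => x; rewrite rest_S !inE => /andP[].
have sz : size l = #|V|.
  by rewrite -(card_uniqP Ul); apply: eq_card.
have [|p ok_p] := certs; first by rewrite -sz size_cat leq_addr.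
have [he hn hp hpairs] := ok rest.
have sym_ok z : size lb <= z -> z.+1 < #|V| ->
    lex_le (code h (Ctx #|V| k (size lb) pairs) x0 l (nth x0 l z.+1))
           (code h (Ctx #|V| k (size lb) pairs) x0 l (nth x0 l z)).
  move=> le_z lt_z; have cdE w : code h (Ctx #|V| k (size lb) pairs) x0 l w = cd w.
    by apply/eq_in_map => j; rewrite mem_iota /= => lt_j; rewrite nth_cat lt_j.
  rewrite !cdE /l !nth_cat !ltnNge (leq_trans le_z) // le_z /= subSn //.
  have /sortedP : sorted le rest by apply: sort_sorted => x y; rewrite /le orbC; apply: lex_le_total.
  by apply; rewrite -subSn // ltn_subLR ?(leq_trans le_z) // -size_cat -/l sz.
apply: (@check_sound _ h h_sym h_irr V F (Ctx #|V| k (size lb) pairs) etF dom_free x0 l) ok_p => //.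
exact: mkst_sat.
Qed.

Lemma colorable_base3 : k = 3 ->
  (7 <= #|V| -> exists p, check (ctx3 #|V|) p (base3 #|V|)) -> colorable h k V.
Proof.
move=> k3 certs.
have [|] := boolP [forall x in V, forall y in V, h x y ==> (simple h V F x || simple h V F y)].
  move=> /forall_inP ok; apply: (colorable3 h_sym h_irr etF k3) => x y xV yV hxy.
  by have /forall_inP/(_ y yV) := ok x xV; rewrite hxy.
rewrite negb_forall => /existsP[b0]; rewrite negb_imply => /andP[b0V].
rewrite negb_forall => /existsP[b1]; rewrite !negb_imply negb_or => /and4P[b1V hb01 ns0 ns1].
have [t tV /andP[ht0 ht1]] := triangle_on h_sym etF k3 b0V b1V.
have h0t : h b0 t by rewrite h_sym.
have h1t : h b1 t by rewrite h_sym.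
have hb10 : h b1 b0 by rewrite h_sym.
(* Since [b] is not simple, it has a neighbour [r] as required by [bad_pair] with [J = [:: b]]. *)
have pick_r b b' : b \in V -> b' \in V -> h b b' -> h b t -> h b' t -> ~~ simple h V F b ->
    exists x y, [/\ [/\ x \in V, y \in V, h x b, h y b & h x y],
      [/\ ~~ h x b', ~~ h x t, ~~ h y b' & ~~ h y t],
      ~~ (inc F x b' && inc F y t || inc F x t && inc F y b'),
      guarded k F [:: b; b'; x] & guarded k F [:: b; t; y]].
  move=> bV b'V hbb' hbt hb't nsb.
  have [/forall_inP all_w|] := boolP [forall w in V, h b w ==> (inc F b' w || inc F t w)].
    case/negP: nsb; apply/exists_inP; exists b' => //; apply/exists_inP; exists t => //.
    by rewrite hbb' hbt hb't; apply/forall_inP.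
  rewrite negb_forall => /existsP[r]; rewrite !negb_imply negb_or => /and4P[rV hbr n1 n2].
  have [|||||||x [y]] := bad_pair h_sym h_irr etF (J := [:: b]) (p := b') (q := t) (r := r);
    rewrite ?k3 //= ?hbb' ?hbt ?hb't //.
  - by move=> u; rewrite !inE => /or4P[] /eqP->.
  - by rewrite h_sym hbr.
  rewrite !andbT => -[[? ? ? ? ?] ? ? ? ?]; exists x, y; split=> //.
have [x [y [[xV yV hx0 hy0 hxy] [nx1 nxt ny1 nyt] pxy F1 F2]]] := pick_r b0 b1 b0V b1V hb01 h0t h1t ns0.
have [x' [y' [[x'V y'V hx1 hy1 hxy'] [nx0 nx't ny0 ny't] pxy' F3 F4]]] := pick_r b1 b0 b1V b0V hb10 h1t h0t ns1.
(* Adjacency to [b0], [b1], [t], then to [x] or [x'], tells the seven vertices apart. *)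
have Ul : uniq [:: b0; b1; t; x; y; x'; y'].
  apply: (@map_uniq _ _ (fun v => [:: h v b0; h v b1; h v t; if h v b0 then h v x else h v x'])).
  have hyx : h y x by rewrite h_sym.
  have hyx' : h y' x' by rewrite h_sym.
  rewrite /= !h_irr hb01 hb10 h0t h1t ht0 ht1 hx0 hy0 hx1 hy1 hyx hyx'.
  rewrite ![h b0 x']h_sym ![h b1 x]h_sym ![h t x]h_sym.
  by rewrite !(negbTE nx1) !(negbTE nxt) !(negbTE ny1) !(negbTE nyt) !(negbTE nx0) !(negbTE nx't) !(negbTE ny0) !(negbTE ny't).
apply: (@colorable_of_base b0 _ pairs3 edges3 nonedges3 positions3 b0V Ul); last by rewrite k3.
  by move=> u; rewrite !inE => /or4P[|||/or4P[]] /eqP->.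
move=> rest /=; split.
- by rewrite hb01 h0t h1t [h b0 x]h_sym hx0 [h b0 y]h_sym hy0 hxy [h b1 x']h_sym hx1 [h b1 y']h_sym hy1 hxy'.
- by rewrite nx1 nxt ny1 nyt nx0 nx't ny0 ny't.
- rewrite F1 F2 F4 !andbT (@guarded_perm _ _ _ _ [:: b1; b0; x']) //.
  by apply/permP => P /=; rewrite addnCA.
- move=> p q z w; rewrite !inE => /orP[] /eqP[-> -> -> ->] //=.
Qed.

Lemma map_nth_iota (x0 : T) s r : map (nth x0 (s ++ r)) (iota 0 (size s)) = s.
Proof.
rewrite -[RHS](@take_size_cat _ _ s r (erefl _)) -(map_nth_iota0 x0) //.
by rewrite size_cat leq_addr.
Qed.

Lemma colorable_baseK : 1 < k ->
  (k.+2 <= #|V| -> exists p, check (ctxK k #|V|) p (baseK k #|V|)) -> colorable h k V.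
Proof.
move=> k_gt1 certs.
have [//|[J [p [q [r [JV szJ hJ hrJ [n1 n2]]]]]]] := bad_clique h_sym h_irr etF k_gt1.
have [x [y [[xV yV hxJ hyJ hxy] [nxp nxq nyp nyq] pxy F1 F2]]] :=
  bad_pair h_sym h_irr etF k_gt1 JV szJ hJ hrJ n1 n2.
have := hJ; rewrite pairwise_cat /= !andbT => /and3P[/allrelP pJ hJJ hpq].
have szJ' : size J = k - 2 by rewrite szJ subn2.
have Ul : uniq (J ++ [:: p; q; x; y]).
  have ninJ z : all (h z) J -> z \notin J.
    by move=> /allP hz; apply/negP => /hz; rewrite h_irr.
  have pJ' : p \notin J.
    by apply/negP => pinJ; have := pJ p p pinJ (mem_head _ _); rewrite h_irr.
  have qJ : q \notin J.
    by apply/negP => qinJ; have := pJ q q qinJ (mem_last p [:: q]); rewrite h_irr.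
  have neq z z' w : h z w -> ~~ h z' w -> z != z' by move=> hz; apply: contraNneq => <-.
  have hqp : h q p by rewrite h_sym.
  have hyx : h y x by rewrite h_sym.
  rewrite cat_uniq; apply/and3P; split.
  - elim: (J) hJJ => //= z s IH /andP[/allP hz /IH ->]; rewrite andbT.
    by apply/negP => /hz; rewrite h_irr.
  - by rewrite /= !negb_or pJ' qJ !ninJ.
  - rewrite /= !inE !negb_or (neq p q q) ?h_irr // (neq p x q) // (neq p y q) //.
    by rewrite (neq q x p) // (neq q y p) // (neq x y y) ?h_irr.
have szl : size (J ++ [:: p; q; x; y]) = k.+2 by rewrite size_cat szJ' (addnA _ 2 2) subnK ?addn2.
apply: (@colorable_of_base p _ (pairsK k) (edgesK k) (nonedgesK k) (positionsK k) _ Ul);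
  last by rewrite szl.
- by apply: JV; rewrite mem_cat !inE eqxx orbT.
- move=> z; rewrite mem_cat !inE => /or4P[zJ|/eqP->|/eqP->|/orP[] /eqP-> //]; apply: JV;
    by rewrite mem_cat !inE ?eqxx ?zJ ?orbT.
move=> rest; set lab := nth p _.
have labJ i : i < k - 2 -> lab i = nth p J i.
  by move=> lt_i; rewrite /lab -catA nth_cat szJ' lt_i.
have labE i : lab (k - 2 + i) = nth p ([:: p; q; x; y] ++ rest) i.
  by rewrite /lab -catA [LHS]nth_cat szJ' ltnNge leq_addr addKn.
have lab_p : lab (k - 2) = p by rewrite -[k - 2]addn0 labE.
have lab_q : lab (k - 1) = q by have := labE 1; rewrite (_ : _ + 1 = k - 1) //; clear -k_gt1; lia.
have lab_x : lab k = x by have := labE 2; rewrite (_ : _ + 2 = k) //; clear -k_gt1; lia.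
have lab_y : lab k.+1 = y by have := labE 3; rewrite (_ : _ + 3 = k.+1) //; clear -k_gt1; lia.
have labs : map lab (iota 0 (k - 2)) = J.
  by rewrite /lab -catA -szJ' map_nth_iota.
split.
- rewrite /edgesK /= lab_p lab_q lab_x lab_y hpq hxy /=.
  apply/allP => _ /flattenP[_ /mapP[i i_in ->] /mapP[j j_in ->]] /=.
  move: i_in j_in; rewrite !mem_iota /= add0n => lt_i /andP[lt_ij lt_j].
  have iJ : nth p J i \in J by rewrite mem_nth ?szJ'.
  rewrite (labJ i lt_i); have [lt_jk|le_kj] := ltnP j (k - 2).
    by rewrite (labJ j lt_jk); apply: (pairwiseP p hJJ) => //; rewrite inE szJ'.
  have : j - (k - 2) < 4 by clear -lt_i lt_j k_gt1; lia.
  rewrite -(subnKC le_kj) labE addKn.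
  case: (j - (k - 2)) => [|[|[|[|//]]]] _ /=.
  + by apply: pJ => //; rewrite mem_head.
  + by apply: pJ => //; rewrite !inE eqxx orbT.
  + by rewrite h_sym; apply: (allP hxJ).
  + by rewrite h_sym; apply: (allP hyJ).
- by rewrite /= lab_p lab_q lab_x lab_y ![h p _]h_sym ![h q _]h_sym nxp nxq nyp nyq.
- by rewrite /= !map_cat labs /= lab_p lab_q lab_x lab_y F1 F2.
- by move=> p' q' z w; rewrite inE => /eqP[-> -> -> ->]; rewrite lab_p lab_q lab_x lab_y.
Qed.
End Bases.

(** * Search for the certificates *)

(* Nothing has to be proved about the search: its results are verified by [check]. *)
Module Search.
Fixpoint ones (r : row) (i : nat) : seq nat :=
  if r is x :: r' then if x then i :: ones r' i.+1 else ones r' i.+1 else [::].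
Fixpoint cnt (r : row) : nat :=
  if r is x :: r' then if x then (cnt r').+1 else cnt r' else 0.
Fixpoint first (r : row) (i : nat) : nat :=
  if r is x :: r' then if x then i else first r' i.+1 else i.
Fixpoint anyb (r : row) : bool := if r is x :: r' then if x then true else anyb r' else false.
Definition neg (r : row) : row := map negb r.

Record gst := G { st : state; log : seq (step * state); bad : option reason; chg : bool }.
Definition do_step (g : gst) (s : step) : gst :=
  G (apply (st g) s) ((s, st g) :: log g) (bad g) true.
Definition fail (g : gst) (r : reason) : gst := G (st g) (log g) (Some r) (chg g).
Definition derN (g : gst) i j r : gst :=
  if bit (non (st g)) i j then g
  else if bit (adj (st g)) i j then fail g r else do_step g (SN i j r).
Definition derA (g : gst) i j r : gst :=
  if bit (adj (st g)) i j then g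
  else if bit (non (st g)) i j then fail g r else do_step g (SA i j r).
Definition alive (g : gst) := if bad g is Some _ then false else true.
Fixpoint gfold (A : Type) (f : A -> gst -> gst) (s : seq A) (g : gst) : gst :=
  if s is x :: s' then if alive g then gfold f s' (f x g) else g else g.

(** * Saturation under the deductions *)

Definition seerows (s : state) : seq row :=
  map (fun c => foldr (fun j r => bor (get (adj s) j) r) (nseq (size c) false) (ones c 0)) (cls s).

Section Gen.
Variables (c : ctx).
Let n := cn c.
Let k := ck c.
Let ids := iota 0 n.

(** Depth-first search of a chain for [inc_of_chain]: choosing [x] keeps only the candidates from
    which [x] is seen. *)
Fixpoint ext (see : seq row) (m : nat) (cand : row) : option (seq nat) :=
  if m is m'.+1 then
    (fix try (l : seq nat) := if l is x :: l' then
        match ext see m' (band cand (get see x)) with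
        | Some r => Some (x :: r) | None => try l' end else None) (ones cand 0)
  else Some [::].

Definition pass_merge1 (bz : nat * nat) (g : gst) : gst :=
  let '(b, z) := bz in
  let s := st g in
  if bit (cls s) b z then g else
  let K := band (get (adj s) b) (get (adj s) z) in
  if cnt K < k.-1 then g else
  match ext (seerows s) k.-1 K with
  | Some cs => do_step g (SM b z cs) | None => g end.
Definition allpairs2 := flatten (map (fun b => map (fun z => (b, z)) (iota 0 b)) ids).
Definition pass_merge := gfold pass_merge1 allpairs2.
Definition pass_cls (g : gst) : gst :=
  gfold (fun i g => gfold (fun j g => if eqn i j then g else derN g i j (RCls i j)) (ones (get (cls (st g)) i) 0) g) ids g.

Fixpoint ins (x : nat) (s : seq nat) := if s is y :: s' then if x <= y then x :: s else y :: ins x s' else [:: x].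
Definition isort (s : seq nat) := foldr ins [::] s.
Definition mem_key (key : seq nat) (P : seq (seq nat * seq nat)) := has (fun q => eqsn key q.1) P.

Fixpoint cliques (A : seq row) (m : nat) (cand : row) (cur : seq nat) (acc : seq (seq nat)) : seq (seq nat) :=
  if m is m'.+1 then
    foldl (fun acc x => cliques A m' (band cand (band (get A x) (nseq x false ++ nseq (n - x) true))) (x :: cur) acc) acc (ones cand 0)
  else cur :: acc.

Definition commonrow (M : seq row) (t : seq nat) : row := foldr (fun i r => band (get M i) r) (nseq n true) t.

Fixpoint sdup (t : seq nat) : bool :=
  match t with x :: ((y :: _) as t') => eqn x y || sdup t' | _ => false end.
Inductive vres := Live | Bad of nat.
Definition viol (see : seq row) (key : seq nat) : vres :=
  if sdup key then Bad 0 else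
  let m := commonrow see key in if anyb m then Bad (first m 0) else Live.

Record ares := AR { alive_pos : seq nat; aw : seq nat; nop : seq nat; akey : seq nat }.
Definition attack (see : seq row) (rp : seq nat) (t : seq nat) (w : nat) : option ares :=
  (fix go (i : nat) (r : seq nat) (acc : ares) : option ares :=
    match r with
    | [::] => Some acc
    | x :: r' =>
      if nget false (get see x) w then go i.+1 r' (AR (alive_pos acc) (0 :: aw acc) (nop acc) (akey acc))
      else
      let key := isort (map (nget 0 rp) (replace t i w)) in
      match viol see key with
      | Live => if alive_pos acc is [::] then go i.+1 r' (AR [:: i] (0 :: aw acc) (i :: nop acc) key) else None
      | Bad u => go i.+1 r' (AR (alive_pos acc) (u :: aw acc) (i :: nop acc) (akey acc))
      end
    end) 0 t (AR [::] [::] [::] [::]).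

Definition proc_w (see : seq row) (rp : seq nat) (t : seq nat) (w : nat)
    (gp : gst * (seq (seq nat * seq nat) * seq (seq nat))) :=
  let '(g, (P, work)) := gp in
  if ~~ alive g then gp else
  match attack see rp t w with
  | None => gp
  | Some a =>
    (* If guard [i] alone is unseen from [w], none of its twins is adjacent to [w], as otherwise the
       attack would have no answer. *)
    let g1 := if nop a is [:: i] then
        gfold (fun y g => derN g w y (RAtt t w [::])) (ones (get (cls (st g)) (nget 0 t i)) 0) g else g in
    if ~~ alive g1 then (g1, (P, work)) else
    match alive_pos a with
    | [::] => (fail g1 (RAtt t w (rev (aw a))), (P, work))
    | i :: _ => if mem_key (akey a) P then (g1, (P, work))
                else let t' := replace t i w in
                     (G (addP (st g1) t') ((SP t w i (rev (aw a)), st g1) :: log g1) (bad g1) (chg g1),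
                      ((akey a, t') :: P, t' :: work))
    end
  end.
Fixpoint pass_work (fuel : nat) (see : seq row) (rp : seq nat) (g : gst)
   (P : seq (seq nat * seq nat)) (work : seq (seq nat)) : gst :=
  if fuel is f.+1 then
    if work is t :: work' then
      if ~~ alive g then g else
      let key := isort (map (nget 0 rp) t) in
      if sdup key then fail g (REq t) else
      let m := commonrow see t in
      if anyb m then fail g (RAtt t (first m 0) [::]) else
      let cl := foldr (fun i r => bor (get (cls (st g)) i) r) [::] t in
      let '(g', (P', work'')) := foldl (fun gp w => proc_w see rp t w gp) (g, (P, work')) (ones (neg cl) 0) in
      pass_work f see rp g' P' work''
    else g
  else g.
Definition pass_pos (g : gst) : gst :=
  let s := st g in
  let see := seerows s in
  let rp := map (fun r => first r 0) (cls s) in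
  let keyed t := (isort (map (nget 0 rp) t), t) in
  let P := foldr (fun t P => let q := keyed t in if mem_key q.1 P then P else q :: P) [::] (pos s) in
  let cl := cliques (adj s) k (nseq n true) [::] [::] in
  let '(g, P) := foldl (fun '(g, P) t => let q := keyed t in
      if mem_key q.1 P then (g, P) else
      (G (addP (st g) t) ((SC t, st g) :: log g) (bad g) (chg g), q :: P)) (g, P) cl in
  pass_work 1000 see rp g P (map snd P).

(** A set [W] of [k.-1] vertices has a common neighbour; a sole remaining candidate is adjacent to
    all of [W]. *)
Fixpoint s1 (A N : seq row) (m : nat) (l : seq nat) (W : seq nat) (com cand : row) (g : gst) : gst :=
  if m is m'.+1 then
    (fix go (l : seq nat) (g : gst) := if l is i :: l' then
       if alive g then go l' (s1 A N m' l' (i :: W) (band com (get A i)) (band cand (get N i)) g) else g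
     else g) l g
  else
    if anyb com then g else
    match cnt cand with
    | 0 => fail g (RS1 W)
    | 1 => let w := first cand 0 in gfold (fun i g => derA g i w (RS1 W)) W g
    | _ => g
    end.
Definition pass_s1 (g : gst) : gst :=
  s1 (adj (st g)) (map neg (non (st g))) k.-1 ids [::] (nseq n true) (nseq n true) g.
(** Only the [y] known to be non-adjacent to [x] are tried: otherwise [y] itself may be the
    neighbour of [x] outside the neighbourhood of [y]. *)
Definition pass_dom (g : gst) : gst :=
  let A' := map neg (adj (st g)) in let N := non (st g) in
  gfold (fun x g => let r := get N x in let nr := neg r in
    gfold (fun y g => if eqn x y then g else
       let d := band nr (get A' y) in
       match cnt d with
       | 0 => fail g (RDom x y)
       | 1 => let w := first d 0 in
              let g := derA g x w (RDom x y) in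
              if alive g then derN g y w (RDom x y) else g
       | _ => g
       end) (ones r 0) g) ids g.
Fixpoint sym1 (z : nat) (js : seq nat) (g : gst) : gst :=
  if js is j :: js' then
    if ~~ alive g then g else
    let s := st g in
    let a1 := bit (adj s) z j in let a0 := bit (non s) z j in
    let b1 := bit (adj s) z.+1 j in let b0 := bit (non s) z.+1 j in
    if (a1 && b1) || (a0 && b0) then sym1 z js' g
    else if a1 && b0 then g
    else if a0 then sym1 z js' (derN g z.+1 j (RSym z j))
    else if b1 then sym1 z js' (derA g z j (RSym z j))
    else g
  else g.
Definition pass_sym (g : gst) : gst :=
  gfold (fun z g => sym1 z (iota 0 (cnb c)) g) (iota (cnb c) (n.-1 - cnb c)) g.
Definition pass_pair (g : gst) : gst :=
  if refutes c (st g) RPair then fail g RPair else g.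
Definition andthen (f : gst -> gst) (g : gst) := if alive g then f g else g.
Definition clear (g : gst) := G (st g) (log g) (bad g) false.
Fixpoint close (fuel : nat) (g : gst) : gst :=
  if fuel is f.+1 then
    let g := clear g in
    let g := andthen pass_merge g in
    let g := andthen pass_cls g in
    let g := andthen pass_pos g in
    let g := andthen pass_s1 g in
    let g := andthen pass_dom g in
    let g := andthen pass_sym g in
    if alive g then if chg g then close f g else pass_pair g else g
  else g.

(** * Choice of the next case *)

Fixpoint insopt (x : nat * nat) (s : seq (nat * nat)) :=
  if s is y :: s' then if x.1 <= y.1 then x :: s else y :: insopt x s' else [:: x].
Definition options (A N : seq row) (cs : seq row) (v : nat) : seq (nat * nat) :=
  let av := get A v in let nv := neg (get N v) in
  (fix go (cs : seq row) (i : nat) (e : bool) : seq (nat * nat) :=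
    if cs is m :: cs' then
      if meets m av then go cs' i.+1 e
      else if anyb m then insopt (cnt (band m nv), i) (go cs' i.+1 e)
      else if e then go cs' i.+1 e else insopt (0, i) (go cs' i.+1 true)
    else [::]) cs 0 false.
Definition hardness (A : seq row) (v : nat) (o : seq (nat * nat)) : seq nat :=
  match o with
  | [::] => [:: 3]
  | [:: x] => [:: 2; x.1; cnt (get A v)]
  | x :: y :: _ => [:: 1; y.1 - x.1; x.1; cnt (get A v)]
  end.
Fixpoint ltn_lex (s t : seq nat) : bool :=
  match s, t with
  | x :: s', y :: t' => (x < y) || (eqn x y && ltn_lex s' t')
  | [::], _ :: _ => true
  | _, _ => false
  end.
Definition bestT := option (nat * seq row).
Definition worse (b : bestT) (cost : nat) : bool := if b is Some (x, _) then x <= cost else false.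
(** Branch and bound on the number of equally coloured pairs not known to be non-adjacent; cost 0
    closes the case. *)
Fixpoint mincol (fuel : nat) (A N : seq row) (rem : seq nat) (cs : seq row) (cost : nat) (b : bestT) : bestT :=
  if worse b cost then b else
  match fuel, rem with
  | f.+1, v0 :: _ =>
    let '(v, o, _) := foldl (fun '(v, o, h) u => let o' := options A N cs u in
         let h' := hardness A u o' in if ltn_lex h h' then (u, o', h') else (v, o, h))
         (v0, [::], [::]) rem in
    let rem' := filter (fun u => ~~ eqn u v) rem in
    foldl (fun b oc => mincol f A N rem' (updr cs oc.2 (fun r => setb r v)) (cost + oc.1) b) b o
  | _, [::] => Some (cost, cs)
  | O, _ => b
  end.

Definition coloring (s : state) : bestT :=
  mincol n (adj s) (non s) ids (nseq k (nseq n false)) 0 None.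

Definition bestS := option (N * (seq nat * row)).
Local Notation nat_N := N.of_nat.
Fixpoint s1best (A N : seq row) (m : nat) (l : seq nat) (W : seq nat) (com cand : row) (b : bestS) : bestS :=
  if m is m'.+1 then
    (fix go (l : seq nat) (b : bestS) := if l is i :: l' then
       go l' (s1best A N m' l' (i :: W) (band com (get A i)) (band cand (get N i)) b)
     else b) l b
  else
    if anyb com then b else
    let sc := N.sub (N.mul 100 (nat_N (cnt cand))) (N.mul 6 (nat_N (foldr (fun i a => cnt (band cand (get A i)) + a) 0 W))) in
    if b is Some (x, _) then if N.ltb sc x then Some (sc, (W, cand)) else b else Some (sc, (W, cand)).
Definition s1_choice (s : state) : bestS :=
  s1best (adj s) (map neg (non s)) k.-1 ids [::] (nseq n true) (nseq n true) None.
Definition s1_edge (s : state) (W : seq nat) (cand : row) : nat * nat :=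
  let '(e, _) := foldl (fun '(e, b) w =>
     let un := filter (fun i => ~~ bit (adj s) i w) W in
     if size un < b then ((head 0 un, w), size un) else (e, b)) ((0, 0), 100) (ones cand 0) in e.
Definition col_edge (s : state) (ms : seq row) : nat * nat :=
  let deg i := cnt (get (adj s) i) in
  let '(e, _) := foldl (fun a m => foldl (fun a i => foldl (fun '(e, b) j =>
      if j < i then let d := (deg i + deg j).+1 in if b < d then ((i, j), d) else (e, b) else (e, b)) a
        (ones (band m (neg (get (non s) i))) 0)) a (ones m 0)) ((0, 0), 0) ms in e.

Inductive choice := CCol of seq row | CEdge of nat & nat | CNone.
Definition choose (s : state) : choice :=
  match coloring s, s1_choice s with
  | Some (0, ms), _ => CCol ms
  | Some (_, ms), None => let '(i, j) := col_edge s ms in CEdge i j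
  | Some (x, ms), Some (y, (W, cand)) =>
      let '(i, j) := if N.leb (N.mul 50 (nat_N x)) y then col_edge s ms else s1_edge s W cand in CEdge i j
  | None, Some (_, (W, cand)) => let '(i, j) := s1_edge s W cand in CEdge i j
  | None, None => CNone
  end.

(** * Pruning of the certificates *)

Record used := U { uE : seq row; uC : row; uP : seq (seq nat) }.
Definition u0 := U (nseq n (nseq n false)) (nseq n false) [::].
Definition pE i j u := U (set2 (uE u) i j) (uC u) (uP u).
Definition pC x y u := if eqn x y then u else U (uE u) (setb (setb (uC u) x) y) (uP u).
Definition pP t u := if has (eqsn t) (uP u) then u else U (uE u) (uC u) (t :: uP u).
Definition pSee (s : state) v x u :=
  if bit (adj s) v x then pE v x u
  else let j := first (band (get (adj s) v) (get (cls s) x)) 0 in pE v j (pC x j u).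
Fixpoint pDist (s : state) (t : seq nat) u :=
  if t is a :: t' then
    let l := filter (bit (cls s) a) t' in
    if l is b :: _ then pC a b u else pDist s t' u
  else u.
Definition pBlocked (s : state) t w i x u :=
  if sees s w (nget 0 t i) then pSee s w (nget 0 t i) u
  else let t' := replace t i w in
       if distinctP s t' then foldr (fun y u => pSee s x y u) u t' else pDist s t' u.
Definition pReason (s : state) (r : reason) (u : used) : used :=
  match r with
  | RCls i j => pE i j (pC i j u)
  | REq t => pP t (pDist s t u)
  | RAtt t w us => pP t (foldr (fun i u => pBlocked s t w i (nget 0 us i) u) u (iota 0 k))
  | RS1 W => foldr (fun w u => let l := filter (fun i => bit (non s) i w) W in
                     if l is i :: _ then if has (eqn w) W then u else pE i w u else u) u ids
  | RDom x y => foldr (fun w u => if bit (non s) x w then pE x w u else pE y w u) u ids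
  | RPair => foldr (fun '(p, q, x, y) u =>
        if bit (cls s) x p && bit (cls s) y q then pC x p (pC y q u) else
        if bit (cls s) x q && bit (cls s) y p then pC x q (pC y p u) else u) u (cpairs c)
  | RSym z j => foldr (fun i u => pE z i (pE z.+1 i u)) u (iota 0 j.+1)
  end.
Fixpoint clrb (a : row) (i : nat) : row :=
  match a, i with
  | [::], _ => [::] | x :: a', O => false :: a' | x :: a', S i' => x :: clrb a' i' end.
Definition clrE i j u := U (updr (updr (uE u) i (fun r => clrb r j)) j (fun r => clrb r i)) (uC u) (uP u).
Definition clrP t u := U (uE u) (uC u) (filter (fun q => ~~ eqsn t q) (uP u)).
Fixpoint pCs (s : state) (cs : seq nat) u :=
  if cs is x :: cs' then foldr (fun y u => pSee s y x u) (pCs s cs' u) cs' else u.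
(** The log runs backwards in time: a step is kept if its conclusion is marked as used, and then its
    premises are marked in turn. *)
Fixpoint trim (l : seq (step * state)) (p : cert) (u : used) : cert * used :=
  if l is (s, s0) :: l' then
    match s with
    | SA i j r => if bit (uE u) i j then trim l' (Step s p) (clrE i j (pReason (addN s0 i j) r (clrE i j u))) else trim l' p u
    | SN i j r => if bit (uE u) i j then trim l' (Step s p) (clrE i j (pReason (addA s0 i j) r (clrE i j u))) else trim l' p u
    | SM b z cs => if meets (uC u) (bor (get (cls s0) b) (get (cls s0) z)) then
         trim l' (Step s p) (pCs s0 cs (foldr (fun x u => pE b x (pE z x u)) (pC b z u) cs)) else trim l' p u
    | SC t => if has (eqsn t) (uP u) then
         trim l' (Step s p) (foldr (fun x u => foldr (fun y u => if eqn x y then u else pE x y u) u t) (clrP t u) t) else trim l' p u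
    | SP t w m us => let t' := replace t m w in
       if has (eqsn t') (uP u) then
         trim l' (Step s p) (pP t (foldr (fun i u => if eqn i m then u else pBlocked s0 t w i (nget 0 us i) u) (clrP t' u) (iota 0 k)))
       else trim l' p u
    end
  else (p, u).
Definition umerge (u v : used) : used :=
  U ((fix go a b := match a, b with x :: a', y :: b' => bor x y :: go a' b' | _, _ => [::] end) (uE u) (uE v))
    (bor (uC u) (uC v)) (foldr (fun t l => if has (eqsn t) l then l else t :: l) (uP v) (uP u)).
Definition pCol (s : state) (ms : seq row) : used :=
  foldr (fun m u => foldr (fun i u => foldr (fun j u => if eqn i j then u else pE i j u) u (ones m 0)) u (ones m 0)) u0 ms.

Fixpoint solve (fuel : nat) (s : state) : cert * used :=
  if fuel is f.+1 then
    let g := close 100 (G s [::] None false) in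
    match bad g with
    | Some r => trim (log g) (Leaf r) (pReason (st g) r u0)
    | None =>
      match choose (st g) with
      | CCol ms => trim (log g) (Col ms) (pCol (st g) ms)
      | CEdge i j =>
        let '(c1, u1) := solve f (addA (st g) i j) in
        if ~~ bit (uE u1) i j then trim (log g) c1 u1 else
        let '(c0, u0') := solve f (addN (st g) i j) in
        if ~~ bit (uE u0') i j then trim (log g) c0 u0' else
        trim (log g) (Br i j c1 c0) (clrE i j (umerge u1 u0'))
      | CNone => (Leaf RPair, u0)
      end
    end
  else (Leaf RPair, u0).
End Gen.
End Search.

(* The lists are evaluated once and for all, so that only the checks below have to be
   redone by the kernel. *)
Definition certs3 := Eval vm_compute in
  [seq (Search.solve (ctx3 n) 200 (base3 n)).1 | n <- iota 7 5].

Lemma certs3_ok :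
  all (fun i => check (ctx3 (7 + i)) (nth (Leaf RPair) certs3 i) (base3 (7 + i))) (iota 0 5) = true.
Proof. vm_cast_no_check (erefl true). Qed.

(** The orders run from [k.+2] to 11, which leaves only [k <= 9]. *)
Definition certsK k := [seq (Search.solve (ctxK k n) 200 (baseK k n)).1 | n <- iota k.+2 (10 - k)].
Definition certs4 := Eval vm_compute in certsK 4.
Definition certs59 := Eval vm_compute in [seq certsK k | k <- iota 5 5].

Lemma certs4_ok : all (fun i => check (ctxK 4 (6 + i)) (nth (Leaf RPair) certs4 i) (baseK 4 (6 + i))) (iota 0 6) = true.
Proof. vm_cast_no_check (erefl true). Qed.

Lemma certs59_ok : all (fun m => let k := 5 + m in all (fun i =>
    check (ctxK k (k.+2 + i)) (nth (Leaf RPair) (nth [::] certs59 m) i) (baseK k (k.+2 + i)))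
  (iota 0 (10 - k))) (iota 0 5) = true.
Proof. vm_cast_no_check (erefl true). Qed.

(** * Induction on the number of vertices *)

Lemma cert3_ex n : 7 <= n -> n <= 11 -> exists p, check (ctx3 n) p (base3 n).
Proof.
move=> le7 le11; exists (nth (Leaf RPair) certs3 (n - 7)).
by have /allP/(_ (n - 7)) := certs3_ok; rewrite mem_iota subnKC //; apply; lia.
Qed.

Lemma certK_ex k n : 3 < k -> k.+2 <= n -> n <= 11 -> exists p, check (ctxK k n) p (baseK k n).
Proof.
rewrite leq_eqVlt => /predU1P[<-|k5] le_n le11.
  exists (nth (Leaf RPair) certs4 (n - 6)).
  by have /allP/(_ (n - 6)) := certs4_ok; rewrite mem_iota subnKC //; apply; lia.
exists (nth (Leaf RPair) (nth [::] certs59 (k - 5)) (n - k.+2)).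
have /allP/(_ (k - 5)) := certs59_ok; rewrite mem_iota subnKC //= => /(_ _)/allP/(_ (n - k.+2)).
by rewrite mem_iota subnKC //; apply; lia.
Qed.

Section Induction.
Variables (T : finType) (h : rel T).
Hypotheses (h_sym : symmetric h) (h_irr : irreflexive h).

(* Positions avoiding [x] exist since some [k]-clique contains [y], which is not
   adjacent to [x]; they remain eternal since [y] replaces [x] as a common neighbour. *)
Lemma eternal_dominated k V F x y : eternal h k V F -> x \in V -> y \in V -> x != y ->
  {in V, forall w, h x w -> h y w} -> eternal h k (V :\ x) [set S in F | x \notin S].
Proof.
move=> etF xV yV neq sub; have nhxy : ~~ h x y.
  by apply/negP => /(sub y yV); rewrite h_irr.
split.
- case: (posnP k) => [k0|k_gt0].
    have [S SF] := eternal_ex etF; exists S.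
    by rewrite inE SF; have /eqP := eternal_card etF SF; rewrite k0 cards_eq0 => /eqP->; rewrite inE.
  have [||| K [yK KV Kc Kk]] := @clique_extend _ _ h_sym h_irr k V [set y] (eternal_far etF).
  + by rewrite sub1set.
  + by move=> u v /set1P-> /set1P->; rewrite eqxx.
  + by rewrite cards1.
  exists K; rewrite inE (clique_guarded etF) //=.
  by apply: contra nhxy => xK; apply: Kc => //; rewrite -sub1set.
- move=> S /setIdP[SF xS]; rewrite subsetD1 xS andbT; exact: (eternal_sub etF SF).
- by move=> S /setIdP[SF _]; apply: (eternal_card etF SF).
- move=> S v /setIdP[SF xS] /setD1P[vx vV] vS.
  have [u uS /andP[nh S'F]] := eternal_att etF SF vV vS; exists u => //.
  by rewrite nh inE S'F !inE negb_or negb_and eq_sym vx xS orbT.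
- move=> W; rewrite subsetD1 => /andP[WV xW] Wk.
  have [v vV hv] := eternal_far etF WV Wk; have [eqv|neqv] := eqVneq v x.
    exists y; first by rewrite !inE eq_sym neq.
    move=> w wW; rewrite h_sym sub ?(subsetP WV) //.
    by rewrite h_sym -eqv hv.
  by exists v; rewrite ?inE ?neqv.
Qed.

(** The removed vertex [x] takes the colour of [y]. *)
Lemma colorable_dominated k (V : {set T}) x y : x \in V -> y \in V -> x != y ->
  {in V, forall w, h x w -> h y w} -> colorable h k (V :\ x) -> colorable h k V.
Proof.
move=> xV yV neq sub [f f_lt f_ok].
have V' z : z \in V -> z != x -> z \in V :\ x by rewrite !inE => -> ->.
have yV' : y \in V :\ x by apply: V'; rewrite // eq_sym.
exists (fun z => if z == x then f y else f z) => [z zV|z w zV wV hzw].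
  by case: eqVneq => [_|/(V' z zV)]; apply: f_lt.
case: (eqVneq z x) hzw => [-> hxw|nz hzw].
  rewrite ifN; last by apply: contraTneq hxw => ->; rewrite h_irr.
  apply: f_ok (sub _ wV hxw) => //; apply: V' => //.
  by apply: contraTneq hxw => ->; rewrite h_irr.
case: (eqVneq w x) hzw => [-> hzx|nw hzw]; last by apply: f_ok; rewrite ?V'.
by apply: f_ok; rewrite ?yV' ?V' // h_sym sub // h_sym.
Qed.

Lemma eternal_colorable k V F : eternal h k V F -> #|V| <= 11 -> colorable h k V.
Proof.
have [m] := ubnP #|V|; elim: m V F => // m IH V F lt_m etF le11.
have [/exists_inP[x xV /exists_inP[y yV /andP[neq /forall_inP sub]]]|no_dom] := boolP
    [exists x in V, exists y in V, (x != y) && [forall w in V, h x w ==> h y w]].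
  have {}sub : {in V, forall w, h x w -> h y w} by move=> w wV; apply/implyP/sub.
  apply: (colorable_dominated xV yV neq sub); apply: IH (eternal_dominated etF xV yV neq sub) _.
    by move: lt_m; rewrite (cardsD1 x) xV.
  by apply: leq_trans le11; rewrite subset_leq_card ?subD1set.
have dom_free x y : x \in V -> y \in V -> x != y -> exists2 w, w \in V & h x w && ~~ h y w.
  move=> xV yV neq; apply/exists_inP; apply: contraR no_dom.
  rewrite negb_exists => /forallP no; apply/exists_inP; exists x => //.
  apply/exists_inP; exists y => //; rewrite neq; apply/forall_inP => w wV.
  by have := no w; rewrite wV /= negb_and negbK implybE.
have [S SF] := eternal_ex etF.
move: etF {IH}; case: k => [|[|[|[|k]]]] etF.
(* Without guards no attack can be answered, so [V] is empty. *)
- exists (fun=> 0) => [v vV|v w vV]; have := eternal_att etF SF vV;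
    have /eqP := eternal_card etF SF; rewrite cards_eq0 => /eqP->; rewrite inE => /(_ isT)[u];
    by rewrite inE.
(* With a single guard there is no pair [i < j] to consider. *)
- apply: (colorable_of_far h_sym h_irr etF (guarded_enum etF SF)) => x0 i [|j] //.
  by rewrite andbF.
- exact: colorable2 etF _.
- apply: (colorable_base3 h_sym h_irr etF dom_free) => // le7; exact: cert3_ex.
- apply: (colorable_baseK h_sym h_irr etF dom_free) => // le_k; exact: certK_ex.
Qed.
End Induction.

(** * Domination numbers and clique coverings *)

Section Bridge.
Variables (T : finType) (e : rel T).
Hypotheses (e_sym : symmetric e) (e_irr : irreflexive e).

Definition nonadj : rel T := fun x y => (x != y) && ~~ e x y.

Lemma nonadj_sym : symmetric nonadj.
Proof. by move=> x y; rewrite /nonadj eq_sym e_sym. Qed.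

Lemma nonadj_irr : irreflexive nonadj.
Proof. by move=> x; rewrite /nonadj eqxx. Qed.

Lemma domination_number_le D : dominating e D -> domination_number e <= #|D|.
Proof. by move=> domD; rewrite /domination_number; case: arg_minnP; [apply: dominatingT | move=> S _; apply]. Qed.

Lemma clique_covering_number_le P : clique_partition e P -> clique_covering_number e <= #|P|.
Proof.
move=> cP; rewrite /clique_covering_number; case: arg_minnP => [|S _]; last exact.
exact: clique_partition_set1.
Qed.

Lemma eternal_domination_number_le k : guards_suffice e k -> eternal_domination_number e <= k.
Proof.
by move=> gk; rewrite /eternal_domination_number; case: ex_minnP => m _; apply; apply/asboolP.
Qed.

Lemma guards_suffice_eternal : guards_suffice e (eternal_domination_number e).
Proof. by rewrite /eternal_domination_number; case: ex_minnP => m /asboolP. Qed.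

Lemma domination_le_eternal : domination_number e <= eternal_domination_number e.
Proof. by have [D [domD <- _]] := guards_suffice_eternal; apply: domination_number_le. Qed.

(* One guard is kept in every clique of the partition. *)
Lemma guards_suffice_cliques P : clique_partition e P -> guards_suffice e #|P|.
Proof.
case/andP => partP /forall_inP cliP.
have [/eqP covP tiP _] := and3P partP.
have inP v : v \in pblock P v by rewrite mem_pblock covP.
have pbP v : pblock P v \in P by rewrite pblock_mem ?covP.
have cliB u v : u \in pblock P v -> u != v -> e u v.
  move=> uB; apply/implyP; have /forall_inP/(_ u uB) := cliP _ (pbP v).
  by move/forall_inP/(_ v (inP v)).
pose X := transversal P [set: T]; have trX : is_transversal X P [set: T] by apply: transversalP.
have XB v : exists2 u, u \in X & u \in pblock P v.
  exists (transversal_repr v X (pblock P v)).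
    exact: (repr_mem_transversal trX).
  exact: (repr_mem_pblock trX).
pose g (C : {set T}) v := odflt v [pick u in C :&: pblock P v].
(* The strategy must recover the position from the attacks alone; [guards] takes the strategy as an
   argument, hence this separate recursion. *)
pose fix cfg (a : seq T) : {set T} := if a is v :: a' then v |: (cfg a' :\ g (cfg a') v) else X.
pose s : strategy T := fun a v => g (cfg a) v.
have gP (C : {set T}) v : (exists2 u, u \in C & u \in pblock P v) -> g C v \in C :&: pblock P v.
  by rewrite /g => -[u uC uB]; case: pickP => [//|/(_ u)]; rewrite inE uC uB.
have guardsE a : guards X s a = cfg a by elim: a => //= v a ->.
(* If [w] lies outside the clique of [v], the guard that moves comes from the clique of [w], so the
   one of [v] stays. *)
have cfgB a v : exists2 u, u \in cfg a & u \in pblock P v.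
  elim: a v => [|w a IH] v //=; have /setIP[gC gB] := gP _ _ (IH w).
  have [wB|wB] := boolP (w \in pblock P v); first by exists w; rewrite ?setU11.
  have [u uC uB] := IH v; exists u => //; rewrite !inE uC andbT; apply/orP; right.
  apply: contra wB => /eqP equ; rewrite -(def_pblock tiP (pbP v) uB) equ.
  by rewrite (def_pblock tiP (pbP w) gB).
exists X; split; last exists s.
- apply/forallP => v; apply/implyP => vX; have [u uX uB] := XB v.
  apply/exists_inP; exists u => //; apply: cliB => //.
  by apply: contraTneq uX => ->.
- exact: (card_transversal trX).
- move=> a v _; rewrite guardsE => vC; have /setIP[gC gB] := gP _ _ (cfgB a v).
  by split=> //; apply: cliB => //; apply: contraNneq vC => <-.
Qed.

Lemma eternal_le_clique_covering : eternal_domination_number e <= clique_covering_number e.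
Proof.
apply/eternal_domination_number_le; rewrite /clique_covering_number.
case: arg_minnP => [|S cS _]; [exact: clique_partition_set1 | exact: guards_suffice_cliques].
Qed.

Lemma clique_covering_le_colors k : colorable nonadj k [set: T] -> clique_covering_number e <= k.
Proof.
case=> f f_lt f_ok; pose P := preim_partition f [set: T].
have PE B : B \in P -> exists2 x, x \in B & B = [set y | f y == f x].
  case/imsetP => x _ ->; exists x; first by rewrite !inE eqxx.
  by apply/setP => y; rewrite !inE eq_sym.
have cP : clique_partition e P.
  rewrite /clique_partition preim_partitionP; apply/forall_inP => B /PE[z _ ->].
  apply/forall_inP => x; rewrite inE => /eqP fx; apply/forall_inP => y; rewrite inE => /eqP fy.
  apply/implyP => neq; apply/negPn/negP => nexy.
  by have := f_ok x y (in_setT x) (in_setT y); rewrite /nonadj neq nexy fx fy eqxx => /(_ isT).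
apply: leq_trans (clique_covering_number_le cP) _.
have sub : P \subset [set [set y | f y == i] | i : 'I_k].
  apply/subsetP => B /PE[x _ ->]; apply/imsetP.
  by exists (Ordinal (f_lt x (in_setT x))).
by apply: leq_trans (subset_leq_card sub) _; apply: leq_trans (leq_imset_card _ _) _; rewrite card_ord.
Qed.

(** [F] collects the positions reached under legal attacks; [eternal_far] holds because fewer
    vertices than the domination number do not dominate. *)
Lemma eternal_of_guards : guards_suffice e (domination_number e) ->
  exists F, eternal nonadj (domination_number e) [set: T] F.
Proof.
case=> D0 [domD card_D0 [s win]].
have card_g a : legal_attacks D0 s a -> #|guards D0 s a| = domination_number e.
  elim: a => //= v a IH /andP[lg vg]; have [sg _] := win _ _ lg vg.
  rewrite cardsU1 !inE negb_and (negbTE vg) orbT /= add1n -(IH lg) [in RHS](cardsD1 (s a v)) sg.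
  by rewrite add1n.
exists [set S | `[< exists2 a, legal_attacks D0 s a & guards D0 s a = S >]]; split.
- by exists D0; rewrite inE; apply/asboolP; exists [::].
- by move=> S _; apply: subsetT.
- by move=> S; rewrite inE => /asboolP[a lg <-]; apply: card_g.
- move=> S v; rewrite inE => /asboolP[a lg <-] _ vg; have [sg esv] := win _ _ lg vg.
  exists (s a v) => //; rewrite /nonadj esv andbF inE; apply/asboolP.
  by exists (v :: a) => //=; rewrite lg.
- move=> W _ ltW; have : ~~ dominating e W.
    by apply: contraL ltW => /domination_number_le; rewrite -leqNgt.
  rewrite negb_forall => /existsP[v]; rewrite negb_imply => /andP[vW /existsPn no].
  exists v => // w wW; have := no w; rewrite wW /= /nonadj => ->; rewrite andbT.
  by apply: contraNneq vW => <-.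
Qed.
End Bridge.

Theorem mainTheorem13 (T : finType) (e : rel T)
    (e_sym : symmetric e) (e_irr : irreflexive e) (le_n_11 : #|T| <= 11) :
  domination_number e = eternal_domination_number e <->
  domination_number e = clique_covering_number e.
Proof.
have ge := domination_le_eternal e; have et := eternal_le_clique_covering e.
split=> [eq_ge|eq_gt]; apply/eqP; rewrite eqn_leq.
  rewrite (leq_trans ge et); apply: clique_covering_le_colors.
  have [|F etF] := @eternal_of_guards T e; first by rewrite eq_ge; apply: guards_suffice_eternal.
  by apply: (eternal_colorable (nonadj_sym e_sym) (nonadj_irr e) etF); rewrite cardsT.
by rewrite ge eq_gt.
Qed.
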